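(* Let $n\ge 3$, let $c\in\mathbb{R}$, and let $M^n$ be an $n$-dimensional connected hypersurface immersed in a real space form $\mathbb{Q}_c^{n+1}$ of constant sectional curvature $c$, equipped with the induced metric. Then $M^n$ has constant Ricci eigenvalues if and only if $M^n$ is curvature homogeneous.
   Context: $\mathbb{Q}_c^{n+1}$ denotes the simply connected real space form of dimension $n+1$ and constant sectional curvature $c$ (a round sphere, Euclidean space, or a hyperbolic space). Everything is smooth; $M^n$ is given by an immersion $f\colon M^n\to\mathbb{Q}_c^{n+1}$ and carries the induced Riemannian metric $g$, so that $f$ is isometric. A Riemannian manifold $M$ is called curvature homogeneous if for any two points $p,q\in M$ there exists a linear isometry $J_{pq}\colon T_pM\to T_qM$ with $J_{pq}^{*}R_q=R_p$, where $R$ is the Riemann curvature tensor. The Ricci eigenvalues of $M$ at $p$ are the eigenvalues of the self-adjoint Ricci operator $\widehat{\mathrm{Ric}}_p\colon T_pM\to T_pM$ defined by $g(\widehat{\mathrm{Ric}}(X),Y)=\mathrm{Ric}(X,Y)$. $M$ has constant Ricci eigenvalues if these eigenvalues, counted with multiplicity, do not depend on the point $p\in M$. *)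

(* Defs.v *)
From HB Require Import structures.
From mathcomp Require Import all_boot all_order all_algebra.
From mathcomp Require Import all_classical all_reals all_analysis.

Set Implicit Arguments.
Unset Strict Implicit.
Unset Printing Implicit Defensive.

Import Order.TTheory GRing.Theory Num.Theory.
Import numFieldNormedType.Exports.

Local Open Scope classical_set_scope.
Local Open Scope ring_scope.

Definition pderive (R : realType) (n : nat) (V : normedModType R)
    (i : 'I_n) (F : 'rV[R]_n -> V) : 'rV[R]_n -> V :=
  'D_(delta_mx 0 i) F.

Fixpoint Ck_on (R : realType) (n : nat) (V : normedModType R) (k : nat)
    (U : set 'rV[R]_n) (F : 'rV[R]_n -> V) : Prop :=
  (forall x, U x -> {for x, continuous F}) /\
  (if k is k'.+1 then
     (forall x (i : 'I_n), U x -> derivable F x (delta_mx 0 i)) /\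
     (forall i : 'I_n, Ck_on k' U (pderive i F))
   else True).

(* Only used for open U. *)
Definition smooth_on (R : realType) (n : nat) (V : normedModType R)
    (U : set 'rV[R]_n) (F : 'rV[R]_n -> V) : Prop :=
  forall k, Ck_on k U F.

(* The charts are the maps [chart i], with domain [dom i] and inverse
   [param i]; the values of [chart i] outside [dom i] and of [param i] outside
   [chart i @` dom i] are irrelevant. *)
Record smooth_manifold (R : realType) (n : nat) := SmoothManifold {
  carrier :> topologicalType;
  manifold_hausdorff : hausdorff_space carrier;
  manifold_second_countable : @second_countable carrier;
  chart_index : Type;
  dom : chart_index -> set carrier;
  chart : chart_index -> carrier -> 'rV[R]_n;
  param : chart_index -> 'rV[R]_n -> carrier;
  dom_open : forall i, open (dom i);
  dom_cover : forall p, exists i, dom i p;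
  chart_image_open : forall i, open (chart i @` dom i);
  chartK : forall i p, dom i p -> param i (chart i p) = p;
  chart_continuous : forall i p, dom i p -> {for p, continuous (chart i)};
  param_continuous : forall i x, (chart i @` dom i) x ->
    {for x, continuous (param i)};
  transition_smooth : forall i j,
    smooth_on (chart i @` (dom i `&` dom j)) (chart j \o param i)
}.

(* The form is Euclidean on R^(n+2) if 0 <= c, and Lorentzian if c < 0. *)
Definition ambient_form (R : realType) (n : nat) (c : R)
    (x y : 'rV[R]_n.+2) : R :=
  \sum_(i < n.+2)
    (if (c < 0) && (i == ord0) then -1 else 1) * x 0 i * y 0 i.

(* Models of Q_c^(n+1) inside R^(n+2), all with the metric induced by
   [ambient_form c]: the round sphere of radius 1 / sqrt c for c > 0, the
   hyperplane x_0 = 0 (a copy of Euclidean R^(n+1)) for c = 0, and the upper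
   sheet of the hyperboloid for c < 0. *)
Definition space_form (R : realType) (n : nat) (c : R) : set 'rV[R]_n.+2 :=
  [set x : 'rV[R]_n.+2 | if c == 0 then x 0 ord0 = 0
           else ambient_form c x x = c^-1 /\ (c < 0 -> 0 < x 0 ord0)].

(* The space form is an embedded submanifold of R^(n+2), so smoothness and
   the rank of the differential can be tested in R^(n+2). *)
Definition immersion_in_space_form (R : realType) (n : nat) (c : R)
    (M : smooth_manifold R n) (f : M -> 'rV[R]_n.+2) : Prop :=
  [/\ forall p, space_form c (f p),
      forall i : chart_index M,
        smooth_on (chart i @` dom i) (f \o param i)
    & forall (i : chart_index M) x, (chart i @` dom i) x ->
        row_free (\matrix_(k < n) pderive k (f \o param i) x)].

(* Intrinsic geometry of a metric on an open subset of R^n, given by its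
   matrix of coefficients [g x i j] = g(d_i, d_j) at x.  A row vector u stands
   for the tangent vector \sum_i u_i d_i. *)

Definition metric_coef (R : realType) (n : nat) :=
  'rV[R]_n -> 'M[R]_n.

Definition metric_at (R : realType) (n : nat) (g : metric_coef R n)
    (x u v : 'rV[R]_n) : R :=
  \sum_(i < n) \sum_(j < n) u 0 i * v 0 j * g x i j.

(* nabla_(d_i) d_j = \sum_k (christoffel g i j k) d_k, nabla being the
   Levi-Civita connection *)
Definition christoffel (R : realType) (n : nat) (g : metric_coef R n)
    (i j k : 'I_n) (x : 'rV[R]_n) : R :=
  2^-1 * \sum_(l < n) invmx (g x) k l *
    (pderive i (fun y => g y j l : R^o) x
     + pderive j (fun y => g y i l : R^o) x
     - pderive l (fun y => g y i j : R^o) x).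

(* R(d_i, d_j) d_k = \sum_l (riemann_coef g i j k l) d_l, with the convention
   R(X, Y) = [nabla_X, nabla_Y] - nabla_[X, Y] *)
Definition riemann_coef (R : realType) (n : nat) (g : metric_coef R n)
    (i j k l : 'I_n) (x : 'rV[R]_n) : R :=
  pderive i (christoffel g j k l : _ -> R^o) x
  - pderive j (christoffel g i k l : _ -> R^o) x
  + \sum_(m < n) (christoffel g j k m x * christoffel g i m l x
                  - christoffel g i k m x * christoffel g j m l x).

(* g(R(u, v) w, z) at x *)
Definition riemann_at (R : realType) (n : nat) (g : metric_coef R n)
    (x u v w z : 'rV[R]_n) : R :=
  metric_at g x
    (\row_l \sum_(i < n) \sum_(j < n) \sum_(k < n)
       u 0 i * v 0 j * w 0 k * riemann_coef g i j k l x) z.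

(* Ric(Y, Z) = trace (X |-> R(X, Y) Z) *)
Definition ricci (R : realType) (n : nat) (g : metric_coef R n)
    (x : 'rV[R]_n) : 'M[R]_n :=
  \matrix_(j, k) \sum_(i < n) riemann_coef g i j k i x.

(* Acts on row vectors by u |-> u *m ricci_operator g x, so that
   g(u *m ricci_operator g x, v) = Ric(u, v). *)
Definition ricci_operator (R : realType) (n : nat) (g : metric_coef R n)
    (x : 'rV[R]_n) : 'M[R]_n :=
  ricci g x *m invmx (g x).

Definition induced_metric (R : realType) (n : nat) (c : R)
    (M : smooth_manifold R n) (f : M -> 'rV[R]_n.+2) (i : chart_index M) :
    metric_coef R n :=
  fun x => \matrix_(k, l)
    ambient_form c (pderive k (f \o param i) x) (pderive l (f \o param i) x).

(* A Riemannian metric on M is given by its coefficients in every chart.  The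
   space T_pM is identified with R^n by the coordinate frame of a chart at p;
   both definitions below range over all the charts at p and at q. *)

Definition curvature_homogeneous (R : realType) (n : nat)
    (M : smooth_manifold R n) (g : chart_index M -> metric_coef R n) : Prop :=
  forall (p q : M) (i j : chart_index M), dom i p -> dom j q ->
  exists J : {linear 'rV[R]_n -> 'rV[R]_n},
    (forall u v, metric_at (g j) (chart j q) (J u) (J v)
                 = metric_at (g i) (chart i p) u v) /\
    (forall u v w z,
       riemann_at (g j) (chart j q) (J u) (J v) (J w) (J z)
       = riemann_at (g i) (chart i p) u v w z).

(* The Ricci operator is self-adjoint, so the multiplicity of an eigenvalue is
   the dimension of its eigenspace (which is 0 for a non-eigenvalue). *)
Definition constant_ricci_eigenvalues (R : realType) (n : nat)
    (M : smooth_manifold R n) (g : chart_index M -> metric_coef R n) : Prop :=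
  forall (p q : M) (i j : chart_index M), dom i p -> dom j q ->
  forall a : R,
    \rank (eigenspace (ricci_operator (g i) (chart i p)) a)
    = \rank (eigenspace (ricci_operator (g j) (chart j q)) a).

(* Main.v *)
Require Import Defs.
From mathcomp Require Import all_boot all_order all_algebra.
From mathcomp Require Import all_classical all_reals all_analysis.
From mathcomp Require Import fingroup perm.
From mathcomp Require Import complex ring lra.

Set Implicit Arguments.
Unset Strict Implicit.
Unset Printing Implicit Defensive.

Import Order.TTheory GRing.Theory Num.Theory.
Import numFieldNormedType.Exports.
Local Open Scope classical_set_scope.
Local Open Scope ring_scope.

(** Write [A] for the shape operator of the hypersurface, [l_1, ..., l_n] for its
    eigenvalues (the principal curvatures) and [H] for their sum.  By the Gauss
    equation, in an orthonormal frame of principal directions the curvature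
    tensor has the sectional curvatures [c + l_i l_j] and no other component,
    and the Ricci operator has the eigenvalues [(n - 1) c + w_i], where
    [w_i = l_i (H - l_i)].  So the curvature tensor is determined, up to a linear
    isometry, by the products [l_i l_j] with [i != j] ([gauss_isometry]), and
    constancy of the Ricci eigenvalues says that the multiset of the [w_i] is
    constant.  One implication is immediate, because the Ricci tensor is a trace
    of the curvature tensor ([isometry_ricci]).

    For the other one, fix the [w_i].  They do not determine the products
    [l_i l_j], but they leave only finitely many possibilities for them.  Indeed
    [(2 l_i - H)^2 = H^2 - 4 w_i], and the sum of the [2 l_i - H] is [(2 - n) H];
    with [t = H^2] this reads
      [sum_i (+-) sqrt (t - 4 w_i) +- (n - 2) sqrt t = 0].
    After collecting equal radicands, either some coefficient is nonzero, and
    then the equation has finitely many roots [t] ([finite_zeros_sum_powR]: divide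
    by one term, differentiate, apply the theorem of Rolle, and repeat), hence the
    [l_i] belong to a finite set; or all the coefficients vanish, and looking at
    the radicand [t] one sees that at most two of the [l_i] are nonzero
    ([finite_principal_curvatures]).  In this second case [H] may vary, but the
    only product [l_i l_j] that can be nonzero is the common value of the two
    nonzero [w_i] ([rank_le2_same_products]).

    The characteristic polynomial of [A] is continuous once a continuous unit
    normal is chosen locally, and reversing the normal does not affect the
    products [l_i l_j].  By the finiteness above these products are locally
    constant ([near_same_products]), hence constant, since the hypersurface is
    connected ([constant_ricci_same_products]).

    The geometric input is the Gauss equation ([gauss_equation_hypersurface]),
    computed in a chart from the partial derivatives of the immersion up to
    order three, and the fact that the principal curvatures at a point do not
    depend on the chart, up to a common sign ([chart_change]). *)

(** * Simultaneous diagonalization of two quadratic forms *)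

Definition posdef (R : numDomainType) n (g : 'M[R]_n) :=
  g^T = g /\ forall v : 'rV_n, v != 0 -> 0 < (v *m g *m v^T) 0 0.

(** The rows of [P] are orthonormal for [g] and orthogonal for [h].  When [g] is
    the metric and [h] the second fundamental form, they are principal
    directions and the entries of [l] are the principal curvatures. *)
Definition principal_frame (R : nzRingType) n (g h P : 'M[R]_n) (l : 'rV_n) :=
  P *m g *m P^T = 1%:M /\ P *m h *m P^T = diag_mx l.

Lemma mulmx_realE (R : rcfType) m n p (A : 'M[R[i]%C]_(m, n)) (B : 'M[R]_(n, p)) :
  ((map_mx (@complex.Re R) (A *m map_mx (real_complex R) B)
     = map_mx (@complex.Re R) A *m B)
  * (map_mx (@complex.Im R) (A *m map_mx (real_complex R) B)
     = map_mx (@complex.Im R) A *m B))%type.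
Proof.
have ReD : {morph @complex.Re R : x y / x + y} by case=> ? ? [].
have ImD : {morph @complex.Im R : x y / x + y} by case=> ? ? [].
split; apply/matrixP => i j; rewrite !mxE.
  rewrite (big_morph _ ReD (erefl _)); apply: eq_bigr => k _.
  by rewrite !mxE; case: (A i k) => a b /=; ring.
rewrite (big_morph _ ImD (erefl _)); apply: eq_bigr => k _.
by rewrite !mxE; case: (A i k) => a b /=; ring.
Qed.

Lemma tr_mx11 (R : nzRingType) (M : 'M[R]_1) : M^T = M.
Proof. by apply/matrixP => i j; rewrite mxE !ord1. Qed.

Lemma posdef_unit (R : numFieldType) n (g : 'M[R]_n) : posdef g -> g \in unitmx.
Proof.
case=> _ gp; rewrite -row_free_unit -kermx_eq0; apply/eqP/row_matrixP => i.
apply/eqP; rewrite row0; apply: contraT => /gp.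
by rewrite -row_mul mulmx_ker row0 mul0mx mxE ltxx.
Qed.

(** Over the complex numbers there is an eigenvector [w = x + i y] for an
    eigenvalue [a + i b].  Comparing [x h y] with [y h x] gives
    [b (x g x + y g y) = 0], so the eigenvalue is real, and [x] or [y] is a real
    eigenvector. *)
Lemma real_eigenvector (R : rcfType) n (g h : 'M[R]_n.+1) :
  posdef g -> h^T = h ->
  exists (a : R) (v : 'rV_n.+1), v != 0 /\ v *m h = a *: (v *m g).
Proof.
move=> gp hT; have gu := posdef_unit gp.
pose cx := map_mx (real_complex R).
have [z /eigenvalueP[w wE w0]] :
    exists z, eigenvalue (cx _ _ h *m invmx (cx _ _ g)) z.
  have /closed_rootP[z rz] :
      size (char_poly (cx _ _ h *m invmx (cx _ _ g))) != 1%N.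
    by rewrite size_char_poly.
  by exists z; rewrite eigenvalue_root_char.
have cgu : cx _ _ g \in unitmx by rewrite map_unitmx.
have {}wE : w *m cx _ _ h = z *: (w *m cx _ _ g).
  by rewrite scalemxAl -wE mulmxA mulmxKV.
pose x := map_mx (@complex.Re R) w; pose y := map_mx (@complex.Im R) w.
have xy0 : (x != 0) || (y != 0).
  apply: contraR w0; rewrite negb_or !negbK => /andP[/eqP x0 /eqP y0].
  apply/eqP/matrixP => i j; move/matrixP/(_ i j): x0; move/matrixP/(_ i j): y0.
  by rewrite !mxE; case: (w i j) => /= ? ? -> ->.
case: z wE => a b wE.
have xE : x *m h = a *: (x *m g) - b *: (y *m g).
  have /(congr1 (map_mx (@complex.Re R))) := wE.
  rewrite mulmx_realE => ->; apply/matrixP => i j.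
  have := mulmx_realE w g; case=> /matrixP/(_ i j) + /matrixP/(_ i j).
  rewrite -/x -/y !mxE => <- <-; case: (\sum_j _) => ? ? /=.
  by ring.
have yE : y *m h = a *: (y *m g) + b *: (x *m g).
  have /(congr1 (map_mx (@complex.Im R))) := wE.
  rewrite mulmx_realE => ->; apply/matrixP => i j.
  have := mulmx_realE w g; case=> /matrixP/(_ i j) + /matrixP/(_ i j).
  rewrite -/x -/y !mxE => <- <-; case: (\sum_j _) => ? ? /=.
  by ring.
(* symmetry of [h] and [g] forces the imaginary part of the eigenvalue to be 0 *)
have b0 : b = 0.
  have hs : x *m h *m y^T = y *m h *m x^T.
    by rewrite -[LHS]tr_mx11 !trmx_mul trmxK hT mulmxA.
  have gs : x *m g *m y^T = y *m g *m x^T.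
    by rewrite -[LHS]tr_mx11 !trmx_mul trmxK (proj1 gp) mulmxA.
  have zE (t s : R) (A B : 'M[R]_(1, 1)) : (t *: A + s *: B) 0 0 = t * A 0 0 + s * B 0 0.
    by rewrite !mxE.
  move: hs; rewrite xE yE -scaleNr !mulmxDl -!scalemxAl gs => /matrixP/(_ 0 0).
  rewrite !zE => hs.
  have /eqP : b * ((x *m g *m x^T) 0 0 + (y *m g *m y^T) 0 0) = 0 by lra.
  rewrite mulf_eq0.
  case/orP => [/eqP //|].
  have q0 (u : 'rV_n.+1) : 0 <= (u *m g *m u^T) 0 0.
    by have [->|/(proj2 gp)/ltW//] := eqVneq u 0; rewrite !mul0mx mxE.
  case/orP: xy0 => /(proj2 gp) p /eqP E.
    by move: (q0 y); lra.
  by move: (q0 x); lra.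
move: xE yE; rewrite b0 !scale0r subr0 addr0 => xE yE.
by case/orP: xy0 => u0; [exists a, x | exists a, y].
Qed.

(** Induction on the dimension: split off a real eigenvector [v] and restrict
    both forms to the [g]-orthogonal complement of [v], which is also
    [h]-orthogonal to [v]. *)
Lemma principal_frame_exists (R : rcfType) n (g h : 'M[R]_n) :
  posdef g -> h^T = h -> exists P l, principal_frame g h P l.
Proof.
elim: n g h => [|n IHn] g h gp hT.
  by exists 0, 0; split; apply/matrixP => -[].
have [a [v0 [v0N v0E]]] := real_eigenvector gp hT.
have [v [vN vE]] : exists v : 'rV_n.+1, v *m g *m v^T = 1%:M /\ v *m h = a *: (v *m g).
  have q0 := proj2 gp _ v0N; set q := (_ 0 0) in q0.
  exists ((Num.sqrt q)^-1 *: v0); split; last first.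
    by rewrite -!scalemxAl v0E scalerA [_ * a]mulrC scalerA.
  rewrite linearZ /= -!scalemxAl -scalemxAr scalerA -invfM -expr2.
  rewrite sqr_sqrtr ?ltW// [_ *m _]mx11_scalar -/q scale_scalar_mx mulVf//.
  by rewrite gt_eqF.
have gu := posdef_unit gp.
have vN0 : v != 0.
  apply/eqP => vz; move: vN; rewrite vz !mul0mx => /matrixP/(_ 0 0)/eqP.
  by rewrite !mxE eq_sym oner_eq0.
pose B := g *m v^T.
have rB : \rank B = 1%N.
  apply/eqP; rewrite eqn_leq rank_leq_col lt0n mxrank_eq0.
  apply: contra vN0 => /eqP B0.
  by rewrite -trmx_eq0 -(mulKmx gu v^T) -/B B0 mulmx0.
have [Q [Qf QB]] : exists Q : 'M[R]_(n, n.+1), row_free Q /\ Q *m B = 0.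
  have : \rank (kermx B) = n by rewrite mxrank_ker rB subn1.
  have := row_base_free (kermx B).
  have : row_base (kermx B) *m B = 0 by apply/eqP; rewrite -sub_kermx eq_row_base.
  move: (row_base _) => Q + + rK; rewrite rK in Q *.
  by exists Q.
have Qgp : posdef (Q *m g *m Q^T).
  split; first by rewrite !trmx_mul trmxK (proj1 gp) mulmxA.
  move=> u u0.
  have -> : u *m (Q *m g *m Q^T) *m u^T = (u *m Q) *m g *m (u *m Q)^T.
    by rewrite trmx_mul !mulmxA.
  apply: (proj2 gp); apply: contra u0 => /eqP uQ.
  by apply/eqP/(row_free_inj Qf); rewrite uQ mul0mx.
have QhT : (Q *m h *m Q^T)^T = Q *m h *m Q^T.
  by rewrite !trmx_mul trmxK hT mulmxA.
have [P' [l' [PgE PhE]]] := IHn _ _ Qgp QhT.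
have Qgv : Q *m g *m v^T = 0 by rewrite -mulmxA.
have vgQ : v *m g *m Q^T = 0.
  by apply: trmx_inj; rewrite !trmx_mul trmxK (proj1 gp) mulmxA Qgv trmx0.
have Qhv : Q *m h *m v^T = 0.
  apply: trmx_inj; rewrite !trmx_mul trmxK hT mulmxA vE -scalemxAl vgQ.
  by rewrite scaler0 trmx0.
have blk (S : 'M[R]_n.+1) : col_mx v (P' *m Q) *m S *m (col_mx v (P' *m Q))^T =
    block_mx (v *m S *m v^T) (v *m S *m Q^T *m P'^T)
             (P' *m (Q *m S *m v^T)) (P' *m (Q *m S *m Q^T) *m P'^T) :> 'M[R]_(1 + n).
  by rewrite tr_col_mx mul_col_mx mul_col_row trmx_mul !mulmxA.
exists (col_mx v (P' *m Q)), (row_mx (a%:M : 'rV[R]_1) l').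
split; rewrite (blk _).
  by rewrite vN vgQ Qgv PgE mul0mx mulmx0 -scalar_mx_block.
have -> : v *m h *m v^T = a%:M by rewrite vE -scalemxAl vN scale_scalar_mx mulr1.
have -> : v *m h *m Q^T = 0 by rewrite vE -scalemxAl vgQ scaler0.
rewrite Qhv PhE mul0mx mulmx0 (diag_mx_row (a%:M : 'rV[R]_1) l').
by rewrite [diag_mx a%:M](_ : _ = a%:M)//; apply/matrixP => i j; rewrite !ord1 !mxE.
Qed.

Section Frames.
Variables (R : fieldType) (n : nat).
Implicit Types (g h P D : 'M[R]_n) (l : 'rV[R]_n).

Lemma principal_frame_unit g h P l :
  principal_frame g h P l -> P \in unitmx /\ g \in unitmx.
Proof.
case=> gE _; have [Pu _] := mulmx1_unit gE; move: Pu; rewrite unitmx_mul => /andP[-> ->].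
by [].
Qed.

Lemma principal_frame_inv g h P l :
  principal_frame g h P l -> P^T *m P = invmx g.
Proof.
move=> fr; have [Pu gu] := principal_frame_unit fr; case: fr => gE _.
have PTu : P^T \in unitmx by rewrite unitmx_tr.
have gPP : g *m (P^T *m P) = 1%:M by rewrite mulmxA (mulmx1C (etrans (mulmxA _ _ _) gE)).
by rewrite -[RHS]mulmx1 -gPP mulKmx.
Qed.

Lemma principal_frame_conj g h P l :
  principal_frame g h P l -> P *m (h *m invmx g) = diag_mx l *m P.
Proof.
by move=> fr; rewrite -(principal_frame_inv fr) -(proj2 fr) !mulmxA.
Qed.

(** How a frame and its eigenvalues are carried along a change of coordinates
    [D] that also reverses the normal when [e = -1]. *)
Lemma principal_frame_congr g h g' h' P D l (e : R) :
  e * e = 1 -> g = D *m g' *m D^T -> h = e *: (D *m h' *m D^T) ->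
  principal_frame g h P l -> principal_frame g' h' (P *m D) (e *: l).
Proof.
move=> ee -> -> [gE hE]; split; first by rewrite trmx_mul -gE !mulmxA.
rewrite linearZ /= -hE -scalemxAr -scalemxAl scalerA ee scale1r.
by rewrite trmx_mul !mulmxA.
Qed.

Lemma char_poly_conj A B P : P \in unitmx -> P *m A = B *m P ->
  char_poly A = char_poly B.
Proof.
move=> Pu PAB; pose Q := map_mx (@polyC R) P.
have Q0 : \det Q != 0.
  by rewrite det_map_mx polyC_eq0 -unitfE -unitmxE.
apply: (mulfI Q0); rewrite [RHS]mulrC -!det_mulmx; congr (\det _).
by rewrite mulmxBr mulmxBl -!map_mxM PAB scalar_mxC.
Qed.

Lemma principal_frame_char_poly g h P l : principal_frame g h P l ->
  char_poly (h *m invmx g) = \prod_i ('X - (l 0 i)%:P).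
Proof.
move=> fr; have [Pu gu] := principal_frame_unit fr.
rewrite (char_poly_conj Pu (principal_frame_conj fr)).
rewrite char_poly_trig ?diag_mx_is_trig//.
by apply: eq_bigr => i _; rewrite mxE eqxx.
Qed.

End Frames.

Lemma mxrank_diag (R : fieldType) n (d : 'rV[R]_n) :
  \rank (diag_mx d) = (\sum_(i < n) (d 0%R i != 0%R))%N.
Proof.
elim: n d => [|n IHn] d; first by rewrite big_ord0 (flatmx0 (diag_mx d)) mxrank0.
have step (d' : 'rV[R]_(1 + n)) : \rank (diag_mx d') =
    ((d' 0%R (lshift n ord0) != 0%R) + \rank (diag_mx (rsubmx d')))%N.
  rewrite -{1}(hsubmxK d') diag_mx_row rank_diag_block_mx; congr (_ + _)%N.
  rewrite rank_rV; congr (nat_of_bool (~~ _)).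
  apply/eqP/eqP => [/matrixP/(_ 0 0)|d0].
    by rewrite !mxE/= mulr1n.
  by apply/matrixP => i j; rewrite !ord1 !mxE/= mulr1n.
rewrite (step d) IHn big_ord_recl; congr (nat_of_bool (d 0%R _ != 0%R) + _)%N.
  exact: val_inj.
apply: eq_bigr => i _; rewrite mxE; congr (nat_of_bool (~~ (d 0%R _ == 0%R))).
exact: val_inj.
Qed.

Lemma mxrank_eigenspace_conj (R : fieldType) n (A B P : 'M[R]_n) a :
  P \in unitmx -> P *m A = B *m P ->
  \rank (eigenspace A a) = \rank (eigenspace B a).
Proof.
move=> Pu PA; rewrite /eigenspace !mxrank_ker.
rewrite -[in RHS](mxrankMfree _ (_ : row_free P)) ?row_free_unit//.
rewrite -[in LHS](eqmxMfull _ (_ : row_full P)) ?row_full_unit//.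
by rewrite mulmxBr PA scalar_mxC -mulmxBl.
Qed.

Lemma mxrank_eigenspace_diag (R : fieldType) n (d : 'rV[R]_n) a :
  \rank (eigenspace (diag_mx d) a) = #|[pred i | d 0 i == a]|.
Proof.
rewrite /eigenspace mxrank_ker -diag_const_mx -linearB /=.
rewrite mxrank_diag -[X in (X - _)%N]card_ord -(cardC [pred i | d 0 i == a]).
have -> : (\sum_(i < n) ((d - const_mx a)%R 0%R i != 0%R))%N =
    #|[predC [pred i | d 0 i == a]]|.
  rewrite -sum1_card [RHS]big_mkcond /=; apply: eq_bigr => i _.
  by rewrite !mxE !inE /= subr_eq0; case: eqP.
by rewrite addnK.
Qed.

(** * Products of pairs of principal curvatures *)

Section SameProducts.
Variables (R : fieldType) (n : nat).
Implicit Types l : 'rV[R]_n.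

(** The equivalence that governs the curvature tensor: for a hypersurface, the
    sectional curvatures of the principal planes are [c + l_i l_j]. *)
Definition same_products l l' :=
  exists s : 'S_n, forall i j, i != j -> l 0 i * l 0 j = l' 0 (s i) * l' 0 (s j).

Lemma same_products_sym l l' : same_products l l' -> same_products l' l.
Proof.
case=> s H; exists (s^-1)%g => i j ij.
by rewrite H ?(inj_eq perm_inj)// !permKV.
Qed.

Lemma same_products_trans l1 l2 l3 :
  same_products l1 l2 -> same_products l2 l3 -> same_products l1 l3.
Proof.
case=> s H [t K]; exists (s * t)%g => i j ij.
by rewrite H// K ?(inj_eq perm_inj)// !permM.
Qed.

Lemma same_products_sign e l : e * e = 1 -> same_products l (e *: l).
Proof.
by move=> ee; exists 1%g => i j _; rewrite !perm1 !mxE mulrACA ee mul1r.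
Qed.

Lemma prod_XsubC_perm l l' :
  \prod_i ('X - (l 0 i)%:P) = \prod_i ('X - (l' 0 i)%:P) ->
  exists s : 'S_n, forall i, l 0 i = l' 0 (s i).
Proof.
pose t (x : 'rV[R]_n) := [tuple x 0 i | i < n].
have tE (x : 'rV[R]_n) : \prod_i ('X - (x 0 i)%:P) = \prod_(z <- t x) ('X - z%:P).
  by rewrite big_tuple; apply: eq_bigr => i _; rewrite tnth_mktuple.
rewrite !tE => /prod_XsubC_eq/tuple_permP[s /val_inj sE].
exists s => i; have := congr1 (fun u => tnth u i) sE.
by rewrite !tnth_mktuple.
Qed.

Lemma same_products_char_poly l l' :
  \prod_i ('X - (l 0 i)%:P) = \prod_i ('X - (l' 0 i)%:P) -> same_products l l'.
Proof.
by move=> /prod_XsubC_perm[s sE]; exists s => i j _; rewrite !sE.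
Qed.

Lemma principal_frame_same_products (g h P P' : 'M[R]_n) l l' :
  principal_frame g h P l -> principal_frame g h P' l' -> same_products l l'.
Proof.
move=> fr fr'; apply: same_products_char_poly.
by rewrite -(principal_frame_char_poly fr) -(principal_frame_char_poly fr').
Qed.

End SameProducts.

(** * Curvature tensors at a point *)

Definition mxform (R : nzRingType) n (B : 'M[R]_n) (u v : 'rV_n) : R :=
  (u *m B *m v^T) 0 0.

Lemma mxformE (R : comNzRingType) n (B : 'M[R]_n) u v :
  mxform B u v = \sum_i \sum_j u 0 i * v 0 j * B i j.
Proof.
rewrite /mxform mxE.
under eq_bigr do rewrite mxE big_distrl /=.
rewrite exchange_big /=; apply: eq_bigr => i _; apply: eq_bigr => j _.
by rewrite mxE mulrAC.
Qed.

Lemma metric_at_mxform (R : realType) n (g : metric_coef R n) x u v :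
  metric_at g x u v = mxform (g x) u v.
Proof. by rewrite mxformE. Qed.

Lemma mxform_mul (R : comNzRingType) m n (B : 'M[R]_n) (D : 'M[R]_(m, n)) u v :
  mxform B (u *m D) (v *m D) = mxform (D *m B *m D^T) u v.
Proof. by rewrite /mxform trmx_mul !mulmxA. Qed.

Lemma mxform_diag (R : comNzRingType) n (d : 'rV[R]_n) u v :
  mxform (diag_mx d) u v = \sum_i d 0 i * (u 0 i * v 0 i).
Proof.
rewrite mxformE; apply: eq_bigr => i _; rewrite (bigD1 i)//= mxE eqxx mulr1n.
rewrite big1 ?addr0 1?mulrC// => j ji.
by rewrite mxE eq_sym (negPf ji) mulr0n mulr0.
Qed.

Lemma mxform_row (R : comNzRingType) n (B P : 'M[R]_n) i j :
  mxform B (row i P) (row j P) = (P *m B *m P^T) i j.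
Proof.
rewrite /mxform -row_mul !mxE; apply: eq_bigr => k _.
by rewrite !mxE.
Qed.

(** The Gauss equation for a second fundamental form [h] with respect to a unit
    normal, in a space of constant curvature [c]. *)
Definition gauss_equation (R : realType) n (c : R) (g : metric_coef R n) x
    (h : 'M[R]_n) := forall u v w z, riemann_at g x u v w z =
  c * (mxform (g x) v w * mxform (g x) u z - mxform (g x) u w * mxform (g x) v z)
  + (mxform h v w * mxform h u z - mxform h u w * mxform h v z).

(** In an orthonormal frame, the trace that defines the Ricci tensor is the sum
    of the diagonal coefficients. *)
Lemma ricci_orthonormal_frame (R : realType) n (g : metric_coef R n) x (P : 'M[R]_n) :
  P *m g x *m P^T = 1%:M -> forall j k,
  (P *m ricci g x *m P^T) j k =
    \sum_i riemann_at g x (row i P) (row j P) (row k P) (row i P).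
Proof.
move=> PgP j k.
have fr : principal_frame (g x) 0 P 0 by split; rewrite // mulmx0 mul0mx linear0.
have [_ gu] := principal_frame_unit fr; have PP := principal_frame_inv fr.
(* the endomorphism [u |-> R(u, e_j) e_k] *)
pose S : 'M[R]_n := \matrix_(i, l) \sum_j' \sum_k' P j j' * P k k' * riemann_coef g i j' k' l x.
have RS i : riemann_at g x (row i P) (row j P) (row k P) (row i P) =
    (P *m (S *m g x) *m P^T) i i.
  rewrite -mxform_row /mxform mulmxA /riemann_at metric_at_mxform /mxform.
  congr ((_ *m _ *m _) 0 0); apply/rowP => l; rewrite !mxE; apply: eq_bigr => i' _.
  rewrite !mxE big_distrr /=; apply: eq_bigr => j' _.
  rewrite big_distrr /=; apply: eq_bigr => k' _.
  by rewrite !mxE !mulrA.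
under eq_bigr do rewrite RS.
transitivity (\tr (P *m (S *m g x) *m P^T)); last by [].
rewrite mxtrace_mulC (mulmxA P^T) PP mxtrace_mulC mulmxK//.
rewrite -mxform_row mxformE /mxtrace.
under [RHS]eq_bigr do rewrite mxE.
rewrite [RHS]exchange_big; apply: eq_bigr => j' _.
rewrite [RHS]exchange_big; apply: eq_bigr => k' _.
by rewrite !mxE big_distrr.
Qed.

Lemma ricci_operator_orthonormal_frame (R : realType) n (g : metric_coef R n) x
    (P : 'M[R]_n) a : P *m g x *m P^T = 1%:M ->
  \rank (eigenspace (ricci_operator g x) a) =
  \rank (eigenspace (P *m ricci g x *m P^T) a).
Proof.
move=> PgP.
have fr : principal_frame (g x) 0 P 0 by split; rewrite // mulmx0 mul0mx linear0.
have [Pu _] := principal_frame_unit fr.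
apply: (mxrank_eigenspace_conj _ Pu).
by rewrite /ricci_operator -(principal_frame_inv fr) !mulmxA.
Qed.

(** The eigenvalues of [H A - A^2], where [A] is the diagonal matrix of [l] and
    [H] its trace.  Up to the constant [(n - 1) c] these are the Ricci eigenvalues
    of a hypersurface with principal curvatures [l]. *)
Definition ricci_weights (R : nzRingType) n (l : 'rV[R]_n) : 'rV[R]_n :=
  \row_i (l 0 i * (\sum_j l 0 j - l 0 i)).

Lemma ricci_eigenspace_gauss (R : realType) n c (g : metric_coef R n) x h P l a :
  gauss_equation c g x h -> principal_frame (g x) h P l ->
  \rank (eigenspace (ricci_operator g x) a) =
  #|[pred i | ricci_weights l 0 i == a - c * n.-1%:R]|.
Proof.
move=> gau [gE hE].
rewrite (ricci_operator_orthonormal_frame _ gE).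
have -> : P *m ricci g x *m P^T = diag_mx (ricci_weights l + const_mx (c * n.-1%:R)).
  apply/matrixP => j k; rewrite (ricci_orthonormal_frame gE).
  have fE i i' : mxform (g x) (row i P) (row i' P) = (i == i')%:R.
    by rewrite mxform_row gE mxE.
  have hE' i i' : mxform h (row i P) (row i' P) = l 0 i *+ (i == i').
    by rewrite mxform_row hE mxE.
  transitivity (\sum_i (c + l 0 i * l 0 j) * ((i != j)%:R * (j == k)%:R)).
    apply: eq_bigr => i _; rewrite gau !fE !hE'.
    have [->|ij] := eqVneq i j; rewrite ?eqxx ?mulr1n ?mulr0n.
      by have [->|jk] := eqVneq j k; rewrite ?eqxx ?(negPf jk) ?mulr1n ?mulr0n; ring.
    have [->|jk] := eqVneq j k; rewrite ?eqxx ?mulr1n ?mulr0n.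
      by rewrite ?(negPf ij) ?mulr0n; ring.
    by rewrite ?mulr0n; ring.
  rewrite !mxE; have [->|jk] := eqVneq j k; last first.
    by rewrite mulr0n big1// => i _; rewrite !mulr0.
  rewrite (bigD1 k)//= eqxx mul0r mulr0 add0r mulr1n [in RHS](bigD1 k)//=.
  under eq_bigr => i ik do rewrite ik !mulr1.
  rewrite big_split /= sumr_const -mulr_suml cardC1 card_ord -mulr_natr.
  ring.
rewrite mxrank_eigenspace_diag; apply: eq_card => i; rewrite !inE !mxE.
by rewrite -[RHS](inj_eq (addIr (c * n.-1%:R))) subrK.
Qed.

(** Map each principal direction to the one with the matching index.  In the
    second term of the Gauss equation, expanded in principal frames, the
    coefficients [l_i l_i] cancel by antisymmetry, and the others agree. *)
Lemma gauss_isometry (R : realType) n c (g g' : metric_coef R n) x x' h h' P P' l l' :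
  gauss_equation c g x h -> gauss_equation c g' x' h' ->
  principal_frame (g x) h P l -> principal_frame (g' x') h' P' l' ->
  same_products l l' ->
  exists J : {linear 'rV[R]_n -> 'rV[R]_n},
    (forall u v, metric_at g' x' (J u) (J v) = metric_at g x u v) /\
    (forall u v w z, riemann_at g' x' (J u) (J v) (J w) (J z)
       = riemann_at g x u v w z).
Proof.
move=> gau gau' fr fr' [s sE]; have [Pu gu] := principal_frame_unit fr.
have [gE hE] := fr; have [gE' hE'] := fr'.
pose K := invmx P *m perm_mx s *m P'; exists (mulmxr K).
have toP (u : 'rV[R]_n) : u = (u *m invmx P) *m P by rewrite mulmxKV.
have JP (u : 'rV[R]_n) : (u *m P) *m K = (u *m perm_mx s) *m P'.
  by rewrite /K !mulmxA mulmxK.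
have cs (u : 'rV[R]_n) i : (u *m perm_mx s) 0 (s i) = u 0 i.
  by rewrite -[s]invgK -col_permE mxE permKV.
have gP u v : mxform (g x) (u *m P) (v *m P) = \sum_i u 0 i * v 0 i.
  rewrite mxform_mul gE -diag_const_mx mxform_diag.
  by apply: eq_bigr => i _; rewrite mxE mul1r.
have gP' u v : mxform (g' x') (u *m P') (v *m P') = \sum_i u 0 i * v 0 i.
  rewrite mxform_mul gE' -diag_const_mx mxform_diag.
  by apply: eq_bigr => i _; rewrite mxE mul1r.
have hP u v : mxform h (u *m P) (v *m P) = \sum_i l 0 i * (u 0 i * v 0 i).
  by rewrite mxform_mul hE mxform_diag.
have hP' u v : mxform h' (u *m P') (v *m P') = \sum_i l' 0 i * (u 0 i * v 0 i).
  by rewrite mxform_mul hE' mxform_diag.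
have iso u v : mxform (g' x') (u *m K) (v *m K) = mxform (g x) u v.
  rewrite (toP u) (toP v); move: (u *m _) (v *m _) => {}u {}v.
  rewrite !JP gP gP' (reindex_inj (@perm_inj _ s)).
  by apply: eq_bigr => i _; rewrite !cs.
split=> [u v|u v w z] /=; first by rewrite !metric_at_mxform iso.
rewrite gau gau' !iso; congr (_ + _).
rewrite (toP u) (toP v) (toP w) (toP z).
move: (u *m _) (v *m _) (w *m _) (z *m _) => {}u {}v {}w {}z.
rewrite !JP !hP !hP'.
(* the terms with [i = j] of the double sum cancel *)
have two_planes (d a1 a2 b1 b2 : 'rV[R]_n) :
    (\sum_i d 0 i * (a1 0 i * a2 0 i)) * (\sum_j d 0 j * (b1 0 j * b2 0 j))
    = \sum_i \sum_j (d 0 i * d 0 j) * (a1 0 i * a2 0 i * (b1 0 j * b2 0 j)).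
  rewrite big_distrl /=; apply: eq_bigr => i _; rewrite big_distrr /=.
  by apply: eq_bigr => j _; rewrite mulrACA.
rewrite !two_planes -!sumrB [LHS](reindex_inj (@perm_inj _ s)).
apply: eq_bigr => i _; rewrite -!sumrB [LHS](reindex_inj (@perm_inj _ s)).
apply: eq_bigr => j _; rewrite !cs.
have [->|ij] := eqVneq i j; first by ring.
by rewrite sE.
Qed.

(** A linear isometry carries an orthonormal frame to an orthonormal frame, and
    in these two frames both Ricci operators have the same matrix. *)
Lemma isometry_ricci (R : realType) n (g g' : metric_coef R n) x x'
    (J : {linear 'rV[R]_n -> 'rV[R]_n}) (P : 'M[R]_n) :
  P *m g x *m P^T = 1%:M ->
  (forall u v, metric_at g' x' (J u) (J v) = metric_at g x u v) ->
  (forall u v w z, riemann_at g' x' (J u) (J v) (J w) (J z)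
     = riemann_at g x u v w z) ->
  forall a, \rank (eigenspace (ricci_operator g x) a) =
            \rank (eigenspace (ricci_operator g' x') a).
Proof.
move=> gE Jg JR a; pose K := lin1_mx J.
have JE u : J u = u *m K by rewrite mul_rV_lin1.
have gE' : (P *m K) *m g' x' *m (P *m K)^T = 1%:M.
  rewrite -gE; apply/matrixP => i j; rewrite -!mxform_row !row_mul.
  by rewrite -!JE -!metric_at_mxform Jg.
rewrite (ricci_operator_orthonormal_frame _ gE) (ricci_operator_orthonormal_frame _ gE').
congr (\rank (eigenspace _ a)); apply/matrixP => j k.
rewrite (ricci_orthonormal_frame gE) (ricci_orthonormal_frame gE').
by apply: eq_bigr => i _; rewrite !row_mul -!JE JR.
Qed.

(** * Sums of shifted powers have finitely many zeros *)

Lemma count_lt (T : eqType) (a b : pred T) (s : seq T) c :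
  subpred a b -> c \in s -> b c -> ~~ a c -> (count a s < count b s)%N.
Proof.
move=> ab cs bc ac.
rewrite !(seq.permP (perm_to_rem cs)).
by rewrite /= bc (negPf ac) add0n add1n ltnS sub_count.
Qed.

(** By Rolle, sending a zero of [f] to the number of smaller zeros of the
    derivative is injective on the zeros of [f]. *)
Lemma finite_zeros_of_derivative (R : realType) (f df : R -> R) (m : R) :
  (forall x, m < x -> is_derive x 1 f (df x)) ->
  finite_set [set x | m < x /\ df x = 0] ->
  finite_set [set x | m < x /\ f x = 0].
Proof.
move=> fdf /finite_seqP[C CE].
pose cnt x := count (fun c => c < x) C.
have incr x y : m < x -> f x = 0 -> f y = 0 -> x < y -> (cnt x < cnt y)%N.
  move=> mx fx fy xy.
  have dr z : z \in `]x, y[%R -> derivable f z 1.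
    by rewrite in_itv /= => /andP[xz _]; case: (fdf z (lt_trans mx xz)).
  have ct : {within `[x, y], continuous f}.
    apply: derivable_within_continuous => z; rewrite in_itv /= => /andP[xz _].
    by case: (fdf z (lt_le_trans mx xz)).
  have [c cxy dc] := Rolle xy dr ct (etrans fx (esym fy)).
  move: cxy; rewrite in_itv /= => /andP[xc cy].
  have cC : c \in C.
    suff : [set` C] c by [].
    rewrite -CE; split; first exact: lt_trans xc.
    have [_ <-] := fdf c (lt_trans mx xc).
    by case: dc.
  apply: (count_lt _ cC cy); last by rewrite -leNgt ltW.
  by move=> z /= zx; exact: lt_trans xy.
set Z := [set x | _].
have inj : {in Z &, injective cnt}.
  move=> x y /set_mem[mx fx] /set_mem[my fy] xy.
  case: (ltgtP x y) => // lt; [move: (incr _ _ mx fx fy lt)|move: (incr _ _ my fy fx lt)];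
    by rewrite xy ltnn.
apply: (card_le_finite (B := cnt @` Z)).
  by have := inj_card_eq inj; rewrite card_eq_le => /andP[].
apply: (sub_finite_set (B := `I_(size C).+1)); last exact: finite_II.
by move=> _ [x _ <-] /=; rewrite ltnS count_size.
Qed.

Lemma powR_shift_is_derive (R : realType) (p nu x : R) : nu < x ->
  is_derive x 1 (fun t => (t - nu) `^ p) (p * (x - nu) `^ (p - 1)).
Proof.
move=> nx; have pos : 0 < x - nu by rewrite subr_gt0.
have d1 := is_derive1_powR p pos.
have d2 : is_derive x 1 (fun t : R => t - nu) 1.
  by apply: is_derive_eq; rewrite ?subr0.
have := @is_derive1_comp _ (fun y => y `^ p) (fun t : R => t - nu) x _ _ d1 d2.
by rewrite mulr1.
Qed.

(** Dividing by [(t - nu0) ^ p], for one of the nodes [nu0], and differentiating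
    gives, up to a nonvanishing factor, a sum of the same kind with one node less,
    the exponent [p - 1] and the coefficients [a_nu (nu - nu0)].  The exponent
    never vanishes because [p] is not a natural number. *)
Lemma finite_zeros_sum_powR (R : realType) (s : seq R) (a : R -> R) (p m : R) :
  uniq s -> (forall nu, nu \in s -> nu <= m) ->
  (forall k : nat, p != k%:R) -> (exists2 nu, nu \in s & a nu != 0) ->
  finite_set [set t | m < t /\ \sum_(nu <- s) a nu * (t - nu) `^ p = 0].
Proof.
elim: s a p => [|n0 s IHs] a p /=; first by move=> _ _ _ [].
move=> /andP[n0s us] sm pk anz.
have [/hasP[n1 n1s an1]|/hasPn az] := boolP (has (fun nu => a nu != 0) s); last first.
  apply: (sub_finite_set (B := set0)) => // t /= [mt].
  rewrite big_cons big_seq big1 ?addr0; last first.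
    by move=> nu /az; rewrite negbK => /eqP ->; rewrite mul0r.
  have tn0 : n0 < t by apply: le_lt_trans mt; apply: sm; rewrite mem_head.
  move/eqP; rewrite mulf_eq0 [X in _ || X]gt_eqF ?powR_gt0 ?subr_gt0// orbF => /eqP an0.
  case: anz => nu; rewrite inE => /orP[/eqP ->|/az]; first by rewrite an0 eqxx.
  by rewrite negbK => ->.
(* divide the sum by its first power and differentiate *)
pose g (t : R) := \sum_(nu <- s) a nu * (t - nu) `^ p.
pose dg (t : R) := \sum_(nu <- s) (a nu * (nu - n0)) * (t - nu) `^ (p - 1).
have sm' nu : nu \in s -> nu <= m by move=> nus; apply: sm; rewrite inE nus orbT.
have n0m : n0 <= m by apply: sm; rewrite mem_head.
have gd t : m < t -> is_derive t 1 g (\sum_(nu <- s) a nu * (p * (t - nu) `^ (p - 1))).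
  move=> mt; rewrite /g; elim: s sm' {IHs n0s us sm anz n1s dg g} => [|nu s IHs] sm'.
    under eq_fun do rewrite big_nil; rewrite big_nil; exact: is_derive_cst.
  under eq_fun do rewrite big_cons; rewrite big_cons.
  apply: is_deriveD; last by apply: IHs => x xs; apply: sm'; rewrite inE xs orbT.
  have := powR_shift_is_derive p (le_lt_trans (sm' nu (mem_head _ _)) mt).
  exact: is_deriveZ.
have fd t : m < t -> is_derive t 1 (fun t => a n0 + g t * (t - n0) `^ (- p))
    (p * (t - n0) `^ (- p - 1) * dg t).
  move=> mt; have d1 := gd t mt.
  have d2 := powR_shift_is_derive (- p) (le_lt_trans n0m mt).
  apply: (is_derive_eq (is_deriveD (is_derive_cst (a n0) t 1) (is_deriveM d1 d2))).
  have tn0 : 0 < t - n0 by rewrite subr_gt0 (le_lt_trans n0m).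
  have qE : (t - n0) `^ (- p) = (t - n0) * (t - n0) `^ (- p - 1).
    rewrite -[X in _ = X * _](powRr1 (ltW tn0)) -powRD; last first.
      by apply/implyP => _; rewrite gt_eqF.
    by rewrite (addrC 1) subrK.
  rewrite add0r.
  transitivity (g t * (- p * (t - n0) `^ (- p - 1)) + (t - n0) `^ (- p) *
     \sum_(nu <- s) a nu * (p * (t - nu) `^ (p - 1))); first by [].
  rewrite qE /g /dg.
  have -> : \sum_(nu <- s) a nu * (p * (t - nu) `^ (p - 1)) =
            p * \sum_(nu <- s) a nu * (t - nu) `^ (p - 1).
    by rewrite big_distrr; apply: eq_bigr => nu _; rewrite mulrCA.
  have -> : \sum_(nu <- s) a nu * (t - nu) `^ p =
            - (\sum_(nu <- s) a nu * (nu - n0) * (t - nu) `^ (p - 1))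
            + (t - n0) * \sum_(nu <- s) a nu * (t - nu) `^ (p - 1).
    rewrite big_distrr -sumrN -big_split big_seq [RHS]big_seq.
    apply: eq_bigr => nu nus /=.
    have tnu : 0 < t - nu by rewrite subr_gt0 (le_lt_trans (sm' nu nus)).
    have -> : (t - nu) `^ p = (t - nu) * (t - nu) `^ (p - 1).
      rewrite -[X in _ = X * _](powRr1 (ltW tnu)) -powRD; last first.
        by apply/implyP => _; rewrite gt_eqF.
      by rewrite (addrC 1) subrK.
    ring.
  move: (\sum_(_ <- _) _) (\sum_(_ <- _) _) => A B.
  ring.
have fin := finite_zeros_of_derivative fd.
apply: (sub_finite_set (B := [set x | m < x /\ a n0 + g x * (x - n0) `^ (- p) = 0])).
  move=> t [mt]; rewrite big_cons -/(g t) => eq0; split => //.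
  have tn0 : 0 < t - n0 by rewrite subr_gt0 (le_lt_trans n0m).
  have := congr1 (fun z => z * (t - n0) `^ (- p)) eq0.
  rewrite mul0r mulrDl -mulrA -powRD ?subrr ?powRr0 ?mulr1 //.
  by apply/implyP => _; rewrite gt_eqF.
apply: fin.
apply: (sub_finite_set (B := [set t | m < t /\ dg t = 0])).
  move=> t [mt /eqP]; rewrite !mulf_eq0 => /orP[/orP[p0|]|/eqP dg0] //.
    by have := pk 0%N; rewrite p0.
  by rewrite gt_eqF// powR_gt0// subr_gt0 (le_lt_trans n0m).
apply: IHs => //.
  by move=> k; have := pk k.+1; apply: contraNN => /eqP pE; rewrite -natr1 -pE subrK.
exists n1 => //; rewrite mulf_neq0// subr_eq0.
by apply: contraNN n0s => /eqP <-.
Qed.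

(** * Principal curvatures with prescribed Ricci weights *)

Lemma sqrt_or (R : rcfType) (x t : R) : x ^+ 2 = t -> x \in [:: Num.sqrt t; - Num.sqrt t].
Proof.
move=> <-; rewrite sqrtr_sqr !inE; case: (ger0P x) => _; rewrite ?eqxx//.
by rewrite opprK eqxx orbT.
Qed.

(** The numbers [2 l_i - H] are square roots of [H^2 - 4 w_i], where the [w_i]
    are the Ricci weights, and add up to [(2 - n) H].  This is that relation, with
    the terms grouped by the value [nu] of [4 w_i]; the term [(n - 2) H] joins the
    group [nu = 0]. *)
Lemma sum_signed_sqrt (R : realType) n (l : 'rV[R]_n) (H : R) (V : seq R) (t := H ^+ 2) :
  H = \sum_i l 0 i -> uniq V -> 0 \in V ->
  (forall i, 4 * ricci_weights l 0 i \in V) ->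
  \sum_(nu <- V) ((\sum_i (4 * ricci_weights l 0 i == nu)%:R * (-1) ^+ (2 * l 0 i - H < 0)%R)
     + (nu == 0)%:R * ((n%:R - 2) * (-1) ^+ (H < 0)%R)) * (t - nu) `^ 2^-1 = 0.
Proof.
move=> HE Vu V0 Vw; rewrite /t.
have pick_nu (F : R -> R) x : x \in V -> \sum_(nu <- V) (x == nu)%:R * F nu = F x.
  move=> xV; rewrite (bigD1_seq x)//= eqxx mul1r big1 ?addr0// => y yx.
  by rewrite eq_sym (negPf yx) mul0r.
have sgnE (x y : R) : x ^+ 2 = y -> (-1) ^+ (x < 0)%R * y `^ 2^-1 = x.
  by move=> <-; rewrite powR12_sqrt ?sqr_ge0// sqrtr_sqr -realEsign// num_real.
under eq_bigr do rewrite mulrDl mulr_suml.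
rewrite big_split /= exchange_big /=.
transitivity (\sum_i (2 * l 0 i - H) + (n%:R - 2) * H).
  congr (_ + _).
    apply: eq_bigr => i _; under eq_bigr do rewrite -mulrA.
    rewrite (pick_nu (fun nu => _ * (H ^+ 2 - nu) `^ _)) ?Vw//.
    by apply: sgnE; rewrite !mxE -HE; ring.
  under eq_bigr do rewrite -!mulrA eq_sym.
  rewrite (pick_nu (fun nu => _ * (_ * (H ^+ 2 - nu) `^ _)))// subr0.
  by rewrite sgnE.
rewrite sumrB -mulr_sumr -HE sumr_const card_ord -mulr_natr; ring.
Qed.

Definition rank_le2 (R : nzRingType) n (l : 'rV[R]_n) :=
  (#|[pred i | l 0%R i != 0%R]| <= 2)%N.

(** A vanishing weight means [l_i = 0] or [l_i = H], and the sign of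
    [2 l_i - H] is opposite to that of [H] in the first case and equal to it in
    the second one.  So the cancellation forces at least [n - 2] of the [l_i] to
    vanish. *)
Lemma cancelling_signs_rank_le2 (R : realFieldType) n (l : 'rV[R]_n) (H : R) :
  H = \sum_i l 0 i -> H != 0 ->
  (\sum_i (4 * ricci_weights l 0 i == 0)%:R * (-1) ^+ (2 * l 0 i - H < 0)%R)
    + (n%:R - 2) * (-1) ^+ (H < 0)%R = 0 :> R -> rank_le2 l.
Proof.
move=> HE H0 sum0.
have le_i i : - (l 0 i == 0)%:R <=
    (4 * ricci_weights l 0 i == 0)%:R * (-1) ^+ (2 * l 0 i - H < 0)%R * (-1) ^+ (H < 0)%R :> R.
  rewrite mulf_eq0 mxE -HE pnatr_eq0 /= mulf_eq0 subr_eq0.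
  have [->|li0] := eqVneq (l 0 i) 0.
    rewrite /= mulr0 add0r mul1r oppr_lt0.
    by case: ltgtP H0 => //= _ _; rewrite ?expr0 ?expr1; lra.
  rewrite /= mulr0n oppr0; case: eqVneq => [->|_]; last by rewrite !mul0r.
  have -> : 2 * l 0 i - l 0 i = l 0 i by ring.
  by rewrite mul1r; case: (_ < _); rewrite ?expr0 ?expr1; lra.
have : - (#|[pred i | l 0 i == 0]|)%:R <= - (n%:R - 2) :> R.
  have -> : - (#|[pred i | l 0 i == 0]|)%:R = \sum_i - (l 0 i == 0)%:R :> R.
    rewrite -sum1_card natr_sum -sumrN big_mkcond /=; apply: eq_bigr => i _.
    by rewrite inE; case: eqP; rewrite ?oppr0.
  apply: le_trans; first by apply: ler_sum => i _; exact: le_i.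
  rewrite -mulr_suml -[\sum_i _](addrK ((n%:R - 2) * (-1) ^+ (H < 0)%R)) sum0.
  by rewrite sub0r mulNr -mulrA -exprD addnn -mul2n exprM sqrrN expr1n expr1n mulr1.
rewrite lerN2 lerBlDr -natrD ler_nat => le_n.
rewrite /rank_le2 -(leq_add2l #|[pred i | l 0 i == 0]|).
rewrite (_ : (_ + _)%N = n) //.
rewrite -[RHS]card_ord -(cardC [pred i | l 0 i == 0]); congr (_ + _)%N.
Qed.

(** Given the weights, there are finitely many sign patterns for the numbers
    [2 l_i - H].  A pattern with a nonzero coefficient leaves finitely many values
    of [H^2]; the remaining patterns force [rank_le2].  Finally [H] and the signs
    determine the [l_i]. *)
Lemma finite_principal_curvatures (R : realType) n (w0 : 'rV[R]_n) :
  exists L : seq R, forall l, ricci_weights l = w0 ->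
    rank_le2 l \/ forall i, l 0 i \in L.
Proof.
pose V := undup (0 :: [seq 4 * w0 0 i | i <- enum 'I_n]).
have Vu : uniq V by apply: undup_uniq.
have V0 : 0 \in V by rewrite mem_undup mem_head.
have Vw i : 4 * w0 0 i \in V.
  by rewrite mem_undup inE (map_f (fun i => 4 * w0 0 i)) ?mem_enum ?orbT.
pose m := \big[Num.max/0]_(nu <- V) nu.
have mV : m \in V.
  rewrite /m big_seq; elim/big_ind : _ => // x y xV yV.
  by rewrite /Num.max; case: ifP.
have Vm nu : nu \in V -> nu <= m by move=> nuV; apply: le_bigmax_seq.
pose b (e : {ffun 'I_n -> bool} * bool) nu : R :=
  (\sum_i (4 * w0 0 i == nu)%:R * (-1) ^+ e.1 i) + (nu == 0)%:R * ((n%:R - 2) * (-1) ^+ e.2).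
pose Z e := [set t | has (fun nu => b e nu != 0) V /\
   (m < t /\ \sum_(nu <- V) b e nu * (t - nu) `^ 2^-1 = 0)].
have Zfin e : finite_set (Z e).
  have [/hasP[nu nuV nu0]|] := boolP (has (fun nu => b e nu != 0) V); last first.
    by move=> /negPf bN; apply: (sub_finite_set (B := set0)) => // t [] /=; rewrite bN.
  apply: sub_finite_set (finite_zeros_sum_powR Vu Vm _ (ex_intro2 _ _ nu nuV nu0)).
    by move=> t [_]; apply.
  move=> k; apply/eqP => /(congr1 (fun x => 2 * x)); rewrite mulfV ?pnatr_eq0//.
  rewrite -natrM => /eqP; rewrite -[1]/(1%:R) eqr_nat => /eqP/(congr1 odd).
  by rewrite oddM.
have : finite_set ([set` V] `|` \bigcup_(e in setT) Z e).
  rewrite finite_setU; split; first exact: finite_seq.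
  by apply: bigcup_finite => //; exact: finite_finset.
case/finite_seqP => T TE.
pose RT (t : R) := [:: Num.sqrt t; - Num.sqrt t].
exists [seq (x + y) / 2 | x <- flatten [seq RT t | t <- T],
                       y <- flatten [seq RT (t - 4 * w0 0 i) | t <- T, i <- enum 'I_n]].
move=> l lw; pose H := \sum_i l 0 i; pose t := H ^+ 2.
have sE i : (2 * l 0 i - H) ^+ 2 = t - 4 * w0 0 i.
  by rewrite -lw mxE -/H /t; ring.
have [lr|lr] := boolP (rank_le2 l); [by left|right].
have tT : t \in T.
  suff : [set` T] t by [].
  rewrite -TE; have [mt|tm] := ltP m t; last first.
    (* all the radicands are nonnegative, so [t] is the largest node *)
    left; rewrite (_ : t = m) //; apply/le_anti; rewrite tm /=.
    have : m \in V := mV.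
    rewrite mem_undup inE => /orP[/eqP ->|/mapP[i _ ->]]; first exact: sqr_ge0.
    by rewrite -subr_ge0 -sE sqr_ge0.
  right; exists ([ffun i => (2 * l 0 i - H < 0)%R], (H < 0)%R) => //.
  have sum0 := @sum_signed_sqrt R n l H V erefl Vu V0.
  rewrite lw in sum0; move: sum0 => /(_ Vw) sum0.
  have bE nu : b ([ffun i => (2 * l 0 i - H < 0)%R], (H < 0)%R) nu =
     (\sum_i (4 * w0 0 i == nu)%:R * (-1) ^+ (2 * l 0 i - H < 0)%R)
     + (nu == 0)%:R * ((n%:R - 2) * (-1) ^+ (H < 0)%R).
    by rewrite /b /=; congr (_ + _); apply: eq_bigr => i _; rewrite ffunE.
  split; last by split=> //; under eq_bigr do rewrite bE.
  apply/hasP; exists 0 => //; rewrite bE eqxx mul1r -lw.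
  apply: contra lr => /eqP; apply: cancelling_signs_rank_le2 => //.
  by have := le_lt_trans (Vm 0 V0) mt; rewrite /t; apply: contraTneq => ->; rewrite expr0n ltxx.
move=> i; apply/allpairsP => /=; exists (H, 2 * l 0 i - H); split => /=.
- apply/flattenP; exists (RT t); first exact: map_f.
  exact: sqrt_or.
- apply/flattenP; exists (RT (t - 4 * w0 0 i)); last exact: sqrt_or.
  by apply/allpairsP; exists (t, i); split; rewrite ?mem_enum.
- by field.
Qed.

Lemma two_points_cover (T : finType) (A : pred T) : (1 < #|T|)%N -> (#|A| <= 2)%N ->
  exists i1 i2, i1 != i2 /\ forall i, A i -> i = i1 \/ i = i2.
Proof.
move=> /card_gt1P[a [b [_ _ ab]]]; rewrite cardE.
have mA i : A i = (i \in enum A) by rewrite mem_enum.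
have := enum_uniq A; case: (enum A) mA => [|c [|d [|? ?]]] // mA u _.
- by exists a, b; split => // i; rewrite mA.
- have [ca|ca] := eqVneq c a.
    by exists a, b; split=> // i; rewrite mA ca inE => /eqP; left.
  by exists c, a; split=> // i; rewrite mA inE => /eqP; left.
- exists c, d; split; first by move: u; rewrite /= inE andbT.
  by move=> i; rewrite mA !inE => /orP[] /eqP; [left|right].
Qed.

(** If only [l_1] and [l_2] may be nonzero, both of the first two weights are
    [l_1 l_2] and the other weights vanish; so the weights determine the only
    product that may be nonzero. *)
Lemma rank_le2_same_products (R : fieldType) n (l l' : 'rV[R]_n) : (1 < n)%N ->
  ricci_weights l = ricci_weights l' -> rank_le2 l -> rank_le2 l' ->
  same_products l l'.
Proof.
move=> n1 ww; rewrite /rank_le2 => r r'; have cn : (1 < #|'I_n|)%N by rewrite card_ord.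
have [i1 [i2 [i12 li]]] := two_points_cover cn r.
have [j1 [j2 [j12 lj]]] := two_points_cover cn r'.
have wE (x : 'rV[R]_n) k1 k2 : k1 != k2 ->
    (forall i, x 0 i != 0 -> i = k1 \/ i = k2) ->
    forall i, ricci_weights x 0 i = (i \in [:: k1; k2])%:R * (x 0 k1 * x 0 k2).
  move=> k12 xk i; rewrite mxE.
  have -> : \sum_j x 0 j = x 0 k1 + x 0 k2.
    rewrite (bigD1 k1)//= (bigD1 k2) 1?eq_sym//= big1 ?addr0// => j /andP[jk1 jk2].
    by apply/eqP; apply: contraT => /xk[] E; rewrite E eqxx in jk1 jk2.
  rewrite !inE; have [->|ik1] := eqVneq i k1; first by rewrite mul1r; ring.
  have [->|ik2] := eqVneq i k2; first by rewrite mul1r; ring.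
  have -> : x 0 i = 0.
    by apply/eqP; apply: contraT => /xk[] E; rewrite E eqxx in ik1 ik2.
  by rewrite !mul0r.
have wl := wE _ _ _ i12 li; have wl' := wE _ _ _ j12 lj.
have PP : l 0 i1 * l 0 i2 = l' 0 j1 * l' 0 j2.
  have e1 := wl i1; have e2 := wl' j1.
  rewrite ww wl' !inE eqxx mul1r in e1; rewrite -ww wl !inE eqxx mul1r in e2.
  case: (_ || _) e1; rewrite ?mul1r// mul0r => e1.
  by case: (_ || _) e2; rewrite ?mul1r// mul0r -e1 => e2.
pose s := (tperm i1 j1 * tperm (tperm i1 j1 i2) j2)%g.
have s1 : s i1 = j1.
  rewrite permM tpermL tpermD ?[j2 == _]eq_sym//.
  by rewrite -{2}(tpermL i1 j1) (inj_eq perm_inj) eq_sym.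
have s2 : s i2 = j2 by rewrite permM tpermL.
have out i : i \notin [:: i1; i2] -> l 0 i = 0 /\ l' 0 (s i) = 0.
  rewrite !inE negb_or => /andP[ii1 ii2]; split; apply/eqP; apply: contraT.
    by move=> /li[] E; rewrite E eqxx in ii1 ii2.
  by move=> /lj[]; rewrite -?s1 -?s2 => /perm_inj E; rewrite E eqxx in ii1 ii2.
exists s => i j ij.
have [|/out[-> ->]] := boolP (i \in [:: i1; i2]); last by rewrite !mul0r.
have [|/out[-> ->]] := boolP (j \in [:: i1; i2]); last by rewrite !mulr0.
rewrite !inE => /orP[] /eqP jE /orP[] /eqP iE; move: ij; rewrite iE jE ?eqxx// => _.
  by rewrite s1 s2 mulrC PP mulrC.
by rewrite s1 s2 PP.
Qed.

(** Equality of multisets.  For Ricci weights, the counts are the dimensions of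
    the eigenspaces of the Ricci operator, up to a shift. *)
Definition same_counts (R : eqType) n (w w' : 'rV[R]_n) :=
  forall a, #|[pred i | w 0 i == a]| = #|[pred i | w' 0 i == a]|.

Lemma same_counts_perm (R : eqType) n (w w' : 'rV[R]_n) :
  same_counts w w' -> exists s : 'S_n, col_perm s w = w'.
Proof.
move=> ww; pose t (x : 'rV[R]_n) := [tuple x 0 i | i < n].
have cnt x a : count_mem a (t x) = #|[pred i | x 0 i == a]|.
  by rewrite count_map -sum1_count /= -sum1_card; apply: congr_big; rewrite ?enumT.
have /tuple_permP[s /val_inj sE] : perm_eq (t w') (t w).
  by apply/allP => a _ /=; rewrite !cnt ww.
exists s; apply/rowP => i; have := congr1 (fun u => tnth u i) sE.
by rewrite !tnth_mktuple mxE.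
Qed.

Lemma ricci_weights_col_perm (R : nzRingType) n (s : 'S_n) (l : 'rV[R]_n) :
  ricci_weights (col_perm s l) = col_perm s (ricci_weights l).
Proof.
apply/rowP => i; rewrite !mxE; congr (_ * (_ - _)).
by rewrite [RHS](reindex_inj (@perm_inj _ s)); apply: eq_bigr => j _; rewrite mxE.
Qed.

Lemma same_products_col_perm (R : fieldType) n (s : 'S_n) (l : 'rV[R]_n) :
  same_products l (col_perm s l).
Proof. by exists (s^-1)%g => i j _; rewrite !mxE !permKV. Qed.

(** The rank condition read off the characteristic polynomial, where it is
    visibly closed. *)
Lemma rank_le2_coef (R : fieldType) n (l : 'rV[R]_n) :
  rank_le2 l <-> forall k, (k + 2 < n)%N -> (\prod_i ('X - (l 0 i)%:P))`_k = 0.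
Proof.
pose Z := [pred i | l 0 i == 0].
have nE : (#|Z| + #|[pred i | l 0%R i != 0%R]|)%N = n.
  by rewrite -[RHS]card_ord -(cardC Z); congr (_ + _)%N.
pose Q := \prod_(i | ~~ Z i) ('X - (l 0 i)%:P).
have PE : \prod_i ('X - (l 0 i)%:P) = 'X^#|Z| * Q.
  rewrite (bigID Z) /=; congr (_ * _).
  rewrite (eq_bigr (fun=> 'X)); first exact: (prodr_const Z).
  by move=> i /eqP ->; rewrite subr0.
have Q0 : Q`_0 != 0.
  rewrite -horner_coef0 /Q horner_prod; apply/prodf_neq0 => i /= zi.
  by rewrite !hornerE oppr_eq0.
rewrite PE /rank_le2; split=> [r k kn|H].
  rewrite coefXnM; case: ltnP => // zk.
  suff : (n <= k + 2)%N by rewrite leqNgt kn.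
  by rewrite -[X in (X <= _)%N]nE leq_add.
rewrite leqNgt; apply/negP => r; move: Q0.
have := H #|Z|; rewrite coefXnM ltnn subnn => ->; rewrite ?eqxx//.
by rewrite -[X in (_ < X)%N]nE ltn_add2l.
Qed.

(** Near [x] the polynomial [p y] differs from each of the finitely many
    polynomials, other than [p x], whose roots are admissible; and if [lx] has
    more than two nonzero entries, so has [l], since a nonzero coefficient of low
    degree of [p x] persists. *)
Lemma near_same_products (R : realType) (T : topologicalType) (x : T)
    (p : T -> {poly R}) n (lx : 'rV[R]_n) : (1 < n)%N ->
  (forall k : nat, {for x, continuous (fun y => (p y)`_k)}) ->
  p x = \prod_i ('X - (lx 0 i)%:P) ->
  \forall y \near x, forall l : 'rV[R]_n, p y = \prod_i ('X - (l 0 i)%:P) ->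
    same_counts (ricci_weights l) (ricci_weights lx) -> same_products l lx.
Proof.
move=> n1 pc px.
have [L LE] := finite_principal_curvatures (ricci_weights lx).
pose Q (phi : {ffun 'I_n -> seq_sub L}) : {poly R} := \prod_i ('X - (val (phi i))%:P).
have near_neq k (a : R) : (p x)`_k != a -> \forall y \near x, (p y)`_k != a.
  move=> pk; apply: (pc k [set z | z != a]).
  exact: open_nbhs_nbhs (conj (@open_neq _ _) _).
have N1 : \forall y \near x, forall phi, Q phi = p x \/ p y != Q phi.
  apply: filter_forall => phi.
  have [QE|QN] := eqVneq (Q phi) (p x); first by near=> y; left.
  have [k kN] : exists k, (p x)`_k != (Q phi)`_k.
    apply: contrapT => H; move/eqP: QN; apply; apply/polyP => k.
    by apply/eqP; apply: contraT => kN; exfalso; apply: H; exists k; rewrite eq_sym.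
  near=> y; right; apply/eqP => yE.
  have : (p y)`_k != (Q phi)`_k by near: y; exact: near_neq.
  by rewrite yE eqxx.
have N2 : \forall y \near x, rank_le2 lx \/
    forall l : 'rV[R]_n, p y = \prod_i ('X - (l 0 i)%:P) -> ~~ rank_le2 l.
  have [r|r] := boolP (rank_le2 lx); first by near=> y; left.
  have [k [kn kN]] : exists k, (k + 2 < n)%N /\ (p x)`_k != 0.
    apply: contrapT => H; move/negP: r; apply; apply/rank_le2_coef => k kn.
    by rewrite -px; apply/eqP; apply: contraT => kN; exfalso; apply: H; exists k.
  near=> y; right => l yE; apply/negP => /rank_le2_coef/(_ k kn); rewrite -yE => y0.
  have : (p y)`_k != 0 by near: y; exact: near_neq.
  by rewrite y0 eqxx.
near=> y => l yE /same_counts_perm[s sE].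
have N1y : forall phi, Q phi = p x \/ p y != Q phi by near: y.
pose l' := col_perm s l.
apply: (same_products_trans (same_products_col_perm s l)); rewrite -/l'.
have lE : \prod_i ('X - (l 0 i)%:P) = \prod_i ('X - (l' 0 i)%:P).
  by rewrite (reindex_inj (@perm_inj _ s)); apply: eq_bigr => i _; rewrite mxE.
have wE : ricci_weights l' = ricci_weights lx by rewrite ricci_weights_col_perm.
have [r|lL] := LE l' wE.
  apply: rank_le2_same_products => //.
  have [//|/(_ l')] : rank_le2 lx \/
    forall l : 'rV[R]_n, p y = \prod_i ('X - (l 0 i)%:P) -> ~~ rank_le2 l.
    by near: y.
  by rewrite yE lE r => /(_ erefl).
pose phi : {ffun 'I_n -> seq_sub L} := [ffun i => SeqSub (lL i)].
have QE : Q phi = \prod_i ('X - (l' 0 i)%:P).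
  by apply: eq_bigr => i _; rewrite ffunE.
apply: same_products_char_poly; rewrite -QE -px.
have [//|] := N1y phi.
by rewrite QE yE lE eqxx.
Unshelve. all: by end_near. Qed.

(** * Entries and determinants *)

(** The determinant is a polynomial in the entries, so every class of functions
    with the closure properties of a ring of functions is stable under it.  It
    applies to continuous functions, to functions differentiable at a point, and
    to families of polynomials with continuous coefficients. *)
Lemma det_closed (K : comNzRingType) (T : Type) (Pr : (T -> K) -> Prop) n (A : T -> 'M[K]_n) :
  (forall a, Pr (fun=> a)) ->
  (forall f g, Pr f -> Pr g -> Pr (fun y => f y + g y)) ->
  (forall f g, Pr f -> Pr g -> Pr (fun y => f y * g y)) ->
  (forall i j, Pr (fun y => A y i j)) -> Pr (fun y => \det (A y)).
Proof.
move=> Pc PD PM PA; rewrite /determinant.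
elim: (index_enum _) => [|s r IHr].
  by under eq_fun do rewrite big_nil; exact: Pc.
under eq_fun do rewrite big_cons; apply: PD => //; apply: (PM (fun=> _)) => //.
elim: (index_enum _) => [|i t IHt].
  by under eq_fun do rewrite big_nil; exact: Pc.
by under eq_fun do rewrite big_cons; apply: PM.
Qed.

(** * Differential calculus in coordinates *)

Lemma is_derive_cvgP (R : realType) (V : normedModType R) (f : V -> R) (x v : V) d :
  is_derive x v f d <-> (fun h : R => h^-1 * (f (h *: v + x) - f x)) @ 0^' --> d.
Proof.
split=> [[df <-]|df]; first exact: df.
by split; [apply/cvg_ex; exists d|apply/cvg_lim].
Qed.

Section Directional.
Variables (R : realType) (V : normedModType R).
Implicit Types (x v : V).

Lemma is_derive_line (f : V -> R) x v (s d : R) :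
  is_derive (x + s *: v) v f d -> is_derive s 1 (fun r : R => f (x + r *: v)) d.
Proof.
move=> /is_derive_cvgP df; apply/is_derive_cvgP.
rewrite (_ : (fun h => _) = (fun h => h^-1 * (f (h *: v + (x + s *: v)) - f (x + s *: v)))) //.
apply/funext => h; congr (_ * (f _ - _)).
by rewrite scalerDl [_ *: 1]mulr1 addrCA.
Qed.

Lemma MVT_line (f df : V -> R) x v (t : R) : 0 <= t ->
  (forall s, 0 <= s <= t -> is_derive (x + s *: v) v f (df (x + s *: v))) ->
  exists2 s, 0 <= s <= t & f (x + t *: v) - f x = df (x + s *: v) * t.
Proof.
move=> t0 fd.
have d1 s : 0 <= s <= t -> is_derive s 1 (fun r : R => f (x + r *: v)) (df (x + s *: v)).
  by move=> /fd; exact: is_derive_line.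
have [||s] := @MVT_segment R (fun r => f (x + r *: v)) (fun r => df (x + r *: v)) 0 t t0.
- by move=> s; rewrite in_itv /= => /andP[/ltW s0 /ltW st]; apply: d1; rewrite s0.
- apply: derivable_within_continuous => s; rewrite in_itv /= => sI.
  by case: (d1 s sI).
by rewrite in_itv /= => sI; rewrite scale0r addr0 subr0; exists s.
Qed.

(** Both orders of differentiation compute the same second difference
    quotient, up to a small displacement of the point. *)
Lemma second_difference (f fi fij : V -> R) x u v (t : R) : 0 <= t ->
  (forall s r, 0 <= s <= t -> 0 <= r <= t ->
     is_derive (x + s *: u + r *: v) u f (fi (x + s *: u + r *: v))) ->
  (forall s r, 0 <= s <= t -> 0 <= r <= t ->
     is_derive (x + s *: u + r *: v) v fi (fij (x + s *: u + r *: v))) ->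
  exists s r, [/\ 0 <= s <= t, 0 <= r <= t &
    f (x + t *: u + t *: v) - f (x + t *: u) - f (x + t *: v) + f x
      = fij (x + s *: u + r *: v) * t ^+ 2].
Proof.
move=> t0 fd fid.
have t01 : 0 <= t <= t by apply/andP.
have z01 : 0 <= (0 : R) <= t by apply/andP.
pose phi y := f (y + t *: v) - f y.
have phid s : 0 <= s <= t -> is_derive (x + s *: u) u phi
    (fi (x + s *: u + t *: v) - fi (x + s *: u)).
  move=> sI.
  have d0 := fd s 0 sI z01; rewrite scale0r addr0 in d0.
  have d1 : is_derive (x + s *: u) u (fun y => f (y + t *: v)) (fi (x + s *: u + t *: v)).
    have /is_derive_cvgP := fd s t sI t01; move=> d1; apply/is_derive_cvgP.
    rewrite (_ : (fun h => _) = (fun h => h^-1 * (f (h *: u + (x + s *: u + t *: v))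
      - f (x + s *: u + t *: v))))//.
    by apply/funext => h; congr (_ * (f _ - _)); rewrite -!addrA.
  exact: is_deriveB.
have [s sI sE] := @MVT_line phi (fun y => fi (y + t *: v) - fi y) _ _ _ t0 phid.
have [r rI rE] := @MVT_line fi fij _ _ _ t0 (fun r => fid s r sI).
exists s, r; split => //.
move: sE; rewrite /phi /= rE => sE.
rewrite expr2 mulrA -sE; ring.
Qed.

End Directional.

(** On a small parallelogram, [second_difference] evaluates the same second
    difference with the mixed derivatives taken in either order; shrink the
    parallelogram. *)
Lemma schwarz (R : realType) (V : normedModType R) (f fi fj fij fji : V -> R)
    (U : set V) (x u v : V) : open U -> U x ->
  (forall y, U y -> is_derive y u f (fi y)) ->
  (forall y, U y -> is_derive y v f (fj y)) ->
  (forall y, U y -> is_derive y v fi (fij y)) ->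
  (forall y, U y -> is_derive y u fj (fji y)) ->
  {for x, continuous fij} -> {for x, continuous fji} -> fij x = fji x.
Proof.
move=> Uo Ux fiE fjE fijE fjiE fijc fjic.
apply/eqP; rewrite -subr_eq0 -normr_le0; apply/ler_addgt0Pl => e e0; rewrite addr0.
have e20 : 0 < e / 2 by rewrite divr_gt0.
have : \forall y \near x, [/\ U y, `|fij x - fij y| < e / 2 & `|fji x - fji y| < e / 2].
  near=> y; split; near: y; first exact: open_nbhs_nbhs.
    by move/cvgrPdist_lt : fijc; apply.
  by move/cvgrPdist_lt : fjic; apply.
move=> /nbhs_ballP[d /= d0 dP].
pose t := d / 2 / (`|u| + `|v| + 1).
have D0 : 0 < `|u| + `|v| + 1 by rewrite ltr_wpDl// addr_ge0.
have t0 : 0 < t by rewrite /t !divr_gt0.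
have inb s r : 0 <= s <= t -> 0 <= r <= t -> ball x d (x + s *: u + r *: v).
  move=> /andP[s0 st] /andP[r0 rt]; rewrite -ball_normE /= -addrA opprD addNKr normrN.
  rewrite (le_lt_trans (ler_normD _ _))// !normrZ !ger0_norm//.
  apply: (@lt_le_trans _ _ (t * (`|u| + `|v| + 1))).
    rewrite !mulrDr mulr1 -[X in X < _]addr0 ler_ltD// lerD// ler_wpM2r//.
  by rewrite divfK ?gt_eqF// ler_pdivrMr// ler_pMr// ler1n.
have inb' s r : 0 <= s <= t -> 0 <= r <= t -> ball x d (x + s *: v + r *: u).
  by move=> sI rI; rewrite addrAC; apply: inb.
have dU y : ball x d y -> U y by move=> /dP[].
have [s [r [sI rI E1]]] := @second_difference _ _ f fi fij _ _ _ _ (ltW t0)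
  (fun s r sI rI => fiE _ (dU _ (inb s r sI rI)))
  (fun s r sI rI => fijE _ (dU _ (inb s r sI rI))).
have [s' [r' [sI' rI' E2]]] := @second_difference _ _ f fj fji _ _ _ _ (ltW t0)
  (fun s r sI rI => fjE _ (dU _ (inb' s r sI rI)))
  (fun s r sI rI => fjiE _ (dU _ (inb' s r sI rI))).
have E : fij (x + s *: u + r *: v) = fji (x + s' *: v + r' *: u).
  apply: (mulIf (_ : t ^+ 2 != 0)); first by rewrite expf_neq0// gt_eqF.
  by rewrite -E1 -E2 [x + t *: v + _]addrAC; ring.
have [_ b1 _] := dP _ (inb s r sI rI).
have [_ _ b2] := dP _ (inb' s' r' sI' rI').
rewrite [leRHS]splitr -(subrKA (fij (x + s *: u + r *: v))).
rewrite (le_trans (ler_normD _ _))// lerD ?(ltW b1)// E distrC ltW//.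
Unshelve. all: by end_near. Qed.

Lemma MVT_line_sym (R : realType) (V : normedModType R) (f df : V -> R) (x v : V) (t : R) :
  (forall s, `|s| <= `|t| -> is_derive (x + s *: v) v f (df (x + s *: v))) ->
  exists2 s, `|s| <= `|t| & f (x + t *: v) - f x = df (x + s *: v) * t.
Proof.
move=> fd; have [t0|t0] := leP 0 t.
  have [|s /andP[s0 st] E] := @MVT_line _ _ f df x v t t0.
    by move=> s /andP[s0 st]; apply: fd; rewrite !ger0_norm.
  by exists s => //; rewrite !ger0_norm.
have nt0 : 0 <= - t by rewrite oppr_ge0 ltW.
have bnd s : 0 <= s <= - t -> `|t + s| <= `|t|.
  by move=> /andP[s0 st]; rewrite (ltr0_norm t0) ler_norml; apply/andP; split; lra.
have [|s sI E] := @MVT_line _ _ f df (x + t *: v) v (- t) nt0.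
  by move=> s sI; rewrite -addrA -scalerDl; apply/fd/bnd.
exists (t + s); first exact: bnd.
have e1 : x + t *: v + (- t) *: v = x by rewrite scaleNr addrK.
have e2 : x + t *: v + s *: v = x + (t + s) *: v by rewrite scalerDl addrA.
by rewrite -opprB -[X in f X - _]e1 E e2 mulrN opprK.
Qed.

Lemma cvg_sum_ord (R : numFieldType) (T : Type) (F : set_system T) {FF : Filter F}
    n (f : 'I_n -> T -> R) (l : 'I_n -> R) :
  (forall i, f i @ F --> l i) -> (fun x => \sum_i f i x) @ F --> \sum_i l i.
Proof. by move=> fl; apply: cvg_big => //; exact: add_continuous. Qed.

Section ChainRule.
Variables (R : realType) (n : nat).
Implicit Types (x w : 'rV[R]_n).

Lemma coord_norm_le w a : `|w 0 a| <= `|w|.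
Proof. by rewrite [leRHS]mx_normrE (le_bigmax _ (fun ij => `|w ij.1 ij.2|) (0, a)). Qed.

Lemma rV_norm_le w (e : R) : 0 <= e -> (forall a, `|w 0 a| <= e) -> `|w| <= e.
Proof.
move=> e0 we; rewrite [leLHS]mx_normrE; apply: bigmax_le => // -[i a] _.
by rewrite ord1.
Qed.

(** Go from [x] to [x + w] by changing one coordinate at a time, and apply the
    mean value theorem to each step. *)
Lemma first_order_expansion (f : 'rV[R]_n -> R) (df : 'I_n -> 'rV[R]_n -> R) x (e : R) :
  (\forall y \near x, forall a, is_derive y (delta_mx 0 a) f (df a y)) ->
  (forall a, {for x, continuous (df a)}) -> 0 < e ->
  exists2 d : R, 0 < d & forall w, `|w| < d ->
    `|f (x + w) - f x - \sum_a w 0 a * df a x| <= e * \sum_a `|w 0 a|.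
Proof.
move=> fd dfc e0.
have : \forall y \near x, (forall a, is_derive y (delta_mx 0 a) f (df a y)) /\
    forall a, `|df a x - df a y| <= e.
  near=> y; split; first by near: y.
  near: y; apply: filter_forall => a.
  by move/cvgrPdist_le : (dfc a); apply.
move=> /nbhs_ballP[d /= d0 dP]; exists d => // w wd.
pose y k := x + \row_a (if (a < k)%N then w 0 a else 0).
have y0 : y 0%N = x by apply/rowP => a; rewrite !mxE ltn0 addr0.
have yn : y n = x + w by apply/rowP => a; rewrite !mxE ltn_ord.
have yS (k : 'I_n) : y k.+1 = y k + w 0 k *: delta_mx 0 k.
  apply/rowP => a; rewrite !mxE -addrA; congr (_ + _).
  rewrite eqxx /= ltnS leq_eqVlt; have -> : (a == k :> nat) = (a == k) by [].
  by have [->|_] := eqVneq a k; rewrite /= ?ltnn ?add0r ?mulr1 ?mulr0 ?addr0.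
have inb (k : 'I_n) s : `|s| <= `|w 0 k| -> ball x d (y k + s *: delta_mx 0 k).
  move=> sw; rewrite -ball_normE /= /y -addrA opprD addNKr normrN.
  apply: le_lt_trans wd; apply: rV_norm_le => // a; rewrite !mxE eqxx /=.
  have [->|_] := eqVneq a k.
    by rewrite ltnn add0r mulr1 (le_trans sw)// coord_norm_le.
  by rewrite mulr0 addr0; case: ifP => _; rewrite ?normr0// coord_norm_le.
have step (k : 'I_n) : `|f (y k.+1) - f (y k) - w 0 k * df k x| <= e * `|w 0 k|.
  have [|s sw E] := @MVT_line_sym _ _ f (df k) (y k) (delta_mx 0 k) (w 0 k).
    by move=> s sw; have [+ _] := dP _ (inb k s sw); apply.
  rewrite yS E mulrC -mulrBr normrM mulrC ler_wpM2r// distrC.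
  by have [_ +] := dP _ (inb k s sw); apply.
have -> : f (x + w) - f x = \sum_(k < n) (f (y k.+1) - f (y k)).
  rewrite -(big_mkord xpredT (fun k => f (y k.+1) - f (y k))).
  by rewrite (telescope_sumr (fun k => f (y k)))// yn y0.
rewrite -sumrB.
by rewrite (le_trans (ler_norm_sum _ _ _))// mulr_sumr ler_sum.
Unshelve. all: by end_near. Qed.

(** Continuity of the partial derivatives of [f] makes up for [phi] being only
    differentiable along [v]. *)
Lemma is_derive_chain (V : normedModType R) (f : 'rV[R]_n -> R)
    (df : 'I_n -> 'rV[R]_n -> R) (phi : V -> 'rV[R]_n) (dphi : 'I_n -> R) (x v : V) :
  (\forall y \near phi x, forall a, is_derive y (delta_mx 0 a) f (df a y)) ->
  (forall a, {for phi x, continuous (df a)}) ->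
  (forall a, is_derive x v (fun y => phi y 0 a) (dphi a)) ->
  is_derive x v (f \o phi) (\sum_a dphi a * df a (phi x)).
Proof.
move=> fd dfc phid; apply/is_derive_cvgP.
pose w (h : R) := phi (h *: v + x) - phi x.
have wd a : (fun h => h^-1 * w h 0 a) @ 0^' --> dphi a.
  have /is_derive_cvgP := phid a; rewrite (_ : (fun h => _) = (fun h => h^-1 * w h 0 a))//.
  by apply/funext => h; rewrite !mxE.
pose lin h := \sum_a (h^-1 * w h 0 a) * df a (phi x).
have lin_cvg : lin @ 0^' --> \sum_a dphi a * df a (phi x).
  by apply: cvg_sum_ord => a; apply: cvgM; [exact: wd | exact: cvg_cst].
apply: (cvg_sub0 _ lin_cvg); apply/cvgr0Pnorm_le => e e0.
pose C := \sum_a (`|dphi a| + 1).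
have C0 : 0 <= C by apply: sumr_ge0 => a _; rewrite addr_ge0.
have [d d0 dP] := first_order_expansion fd dfc (divr_gt0 e0 (ltr_pwDr ltr01 C0)).
have w0 a : (fun h => w h 0 a) @ 0^' --> (0 : R).
  rewrite -[X in _ --> X](mul0r (dphi a)).
  apply: (@cvg_trans _ ((fun h : R => h * (h^-1 * w h 0 a)) @ 0^')).
    apply: near_eq_cvg; near=> h; rewrite mulrA mulfV ?mul1r//.
    by near: h; exact: nbhs_dnbhs_neq.
  by apply: cvgM => //; exact: (@cvg_within _ (nbhs (0 : R))).
near=> h.
have h0 : h != 0 by near: h; exact: nbhs_dnbhs_neq.
have hd : `|w h| < d.
  apply: (@le_lt_trans _ _ (d / 2)); last by rewrite ltr_pdivrMr// ltr_pMr// ltr1n.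
  apply: rV_norm_le; first by rewrite divr_ge0 ?ltW.
  near: h; apply: filter_forall => a.
  by have /cvgr0Pnorm_le := w0 a; apply; rewrite divr_gt0.
have qle' : forall a, `|dphi a - h^-1 * w h 0 a| <= 1.
  near: h; apply: filter_forall => a.
  by have /cvgrPdist_le := wd a; apply.
have qle a : `|h^-1 * w h 0 a| <= `|dphi a| + 1.
  have le1 := qle' a; rewrite -[X in `|X|](subrK (dphi a)) addrC.
  by rewrite (le_trans (ler_normD _ _))// lerD// distrC.
have qE : h^-1 * (f (phi (h *: v + x)) - f (phi x)) - lin h
   = h^-1 * (f (phi x + w h) - f (phi x) - \sum_a w h 0 a * df a (phi x)).
  rewrite /lin [RHS]mulrBr mulr_sumr; congr (_ * (f _ - _) - _).
    by rewrite /w [RHS]addrC subrK.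
  by apply: eq_bigr => a _; rewrite mulrA.
apply: (@le_trans _ _ `|h^-1 * (f (phi (h *: v + x)) - f (phi x)) - lin h|); first by [].
rewrite qE.
rewrite normrM (le_trans (ler_wpM2l _ (dP _ hd)))//.
have -> : `|h^-1| * (e / (C + 1) * \sum_a `|w h 0 a|) = e / (C + 1) * \sum_a `|h^-1 * w h 0 a|.
  by rewrite mulrCA; congr (_ * _); rewrite mulr_sumr; apply: eq_bigr => a _; rewrite normrM.
apply: (@le_trans _ _ (e / (C + 1) * C)).
  by apply: ler_wpM2l; [rewrite divr_ge0 ?addr_ge0// ltW|exact: ler_sum].
by rewrite mulrAC ler_pdivrMr ?ltr_wpDl// ler_pM2l// lerDl.
Unshelve. all: by end_near. Qed.

End ChainRule.

(** * Smooth maps in coordinates *)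

Section SmoothCoordinates.
Variables (R : realType) (n m : nat).
Implicit Types (F : 'rV[R]_n -> 'rV[R]_m) (U : set 'rV[R]_n).

Lemma is_derive_coord F x v a :
  derivable F x v -> is_derive x v (fun y => F y 0 a) ('D_v F x 0 a).
Proof.
move=> dF; rewrite derive_mx// mxE; apply: derivableP.
exact: (proj1 (derivable_mxP _ _ _) dF).
Qed.

Lemma smooth_on_continuous_coord F U x a :
  smooth_on U F -> U x -> {for x, continuous (fun y => F y 0 a)}.
Proof.
move=> Fs Ux; have [Fc _] := Fs 0%N.
apply: (@continuous_comp _ _ _ F (fun M : 'rV[R]_m => M 0 a)); first exact: Fc.
exact: coord_continuous.
Qed.

Lemma smooth_on_pderive F U i : smooth_on U F -> smooth_on U (pderive i F).
Proof. by move=> Fs k; have [_ [_ +]] := Fs k.+1; apply. Qed.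

Lemma smooth_on_is_derive F U x i a : smooth_on U F -> U x ->
  is_derive x (delta_mx 0 i) (fun y => F y 0 a) (pderive i F x 0 a).
Proof.
by move=> Fs Ux; have [_ [dF _]] := Fs 1%N; exact: is_derive_coord (dF _ _ Ux).
Qed.

Lemma smooth_on_pderiveC F U x i j : open U -> smooth_on U F -> U x ->
  pderive i (pderive j F) x = pderive j (pderive i F) x.
Proof.
move=> Uo Fs Ux; apply/rowP => a.
have Fis := smooth_on_pderive i Fs; have Fjs := smooth_on_pderive j Fs.
apply: (@schwarz _ _ (fun y => F y 0 a) (fun y => pderive j F y 0 a)
  (fun y => pderive i F y 0 a) (fun y => pderive i (pderive j F) y 0 a)
  (fun y => pderive j (pderive i F) y 0 a) U _ (delta_mx 0 j) (delta_mx 0 i)) => //.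
- by move=> y; exact: smooth_on_is_derive.
- by move=> y; exact: smooth_on_is_derive.
- by move=> y; exact: smooth_on_is_derive.
- by move=> y; exact: smooth_on_is_derive.
- exact: smooth_on_continuous_coord (smooth_on_pderive i Fjs) Ux.
- exact: smooth_on_continuous_coord (smooth_on_pderive j Fis) Ux.
Qed.

End SmoothCoordinates.

Lemma is_derive_const_on (R : realType) (V : normedModType R) (f : V -> R) U x v d a :
  open U -> U x -> (forall y, U y -> f y = a) -> is_derive x v f d -> d = 0.
Proof.
move=> Uo Ux fa [df <-].
rewrite (near_eq_derive (g := cst a)); first exact: derive_cst.
near=> y; apply: fa; near: y; exact: open_nbhs_nbhs.
Unshelve. all: by end_near. Qed.

(** * The ambient form *)

(** The diagonal of the Gram matrix of the ambient form. *)
Definition ambient_signs (R : realType) n (c : R) : 'rV[R]_n.+2 :=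
  \row_i (if (c < 0) && (i == ord0) then -1 else 1).

Section AmbientForm.
Variables (R : realType) (n : nat) (c : R).
Implicit Types x y z : 'rV[R]_n.+2.
Local Notation E := (diag_mx (ambient_signs n c)).

Lemma ambient_formE x y : ambient_form c x y = mxform E x y.
Proof. by rewrite mxform_diag; apply: eq_bigr => i _; rewrite mxE mulrA. Qed.

Lemma ambient_formC x y : ambient_form c x y = ambient_form c y x.
Proof. by apply: eq_bigr => i _; rewrite mulrAC. Qed.

Lemma ambient_formDl x y z :
  ambient_form c (x + y) z = ambient_form c x z + ambient_form c y z.
Proof. by rewrite !ambient_formE /mxform !mulmxDl mxE. Qed.

Lemma ambient_formZl a x z : ambient_form c (a *: x) z = a * ambient_form c x z.
Proof. by rewrite !ambient_formE /mxform -!scalemxAl mxE. Qed.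

Lemma ambient_form_mxE p q (A : 'M[R]_(p, n.+2)) (B : 'M[R]_(q, n.+2)) i j :
  (A *m E *m B^T) i j = ambient_form c (row i A) (row j B).
Proof.
rewrite ambient_formE /mxform -row_mul !mxE.
by apply: eq_bigr => k _; rewrite !mxE.
Qed.

Lemma is_derive_ambient_form (V : normedModType R) (X Y : V -> 'rV[R]_n.+2)
    (x v : V) (X' Y' : 'rV[R]_n.+2) :
  (forall a, is_derive x v (fun q : V => X q 0 a) (X' 0 a)) ->
  (forall a, is_derive x v (fun q : V => Y q 0 a) (Y' 0 a)) ->
  is_derive x v (fun q : V => ambient_form c (X q) (Y q))
    (ambient_form c X' (Y x) + ambient_form c (X x) Y').
Proof.
move=> dX dY; pose t i q := (if (c < 0) && (i == ord0) then -1 else 1) * X q 0 i * Y q 0 i.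
have dt i : is_derive x v (t i)
   ((if (c < 0) && (i == ord0) then -1 else 1) * X' 0 i * Y x 0 i
    + (if (c < 0) && (i == ord0) then -1 else 1) * X x 0 i * Y' 0 i).
  have d1 := is_deriveM (is_deriveZ (if (c < 0) && (i == ord0) then -1 else 1) (dX i)) (dY i).
  apply: (is_derive_eq d1); rewrite addrC; congr (_ + _).
  exact: mulrC.
have := is_derive_sum dt.
rewrite big_split /= (_ : \sum_(i < n.+2) t i = (fun q : V => ambient_form c (X q) (Y q)))//.
by apply/funext => y; rewrite fct_sumE.
Qed.

Lemma continuous_ambient_form (T : topologicalType) (X Y : T -> 'rV[R]_n.+2)
    (x : T) :
  (forall a, {for x, continuous (fun q : T => X q 0 a)}) ->
  (forall a, {for x, continuous (fun q : T => Y q 0 a)}) ->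
  {for x, continuous (fun q : T => ambient_form c (X q) (Y q))}.
Proof.
move=> cX cY; apply: cvg_sum_ord => i; apply: cvgM; last exact: cY.
apply: cvgM; [exact: cvg_cst|exact: cX].
Qed.

End AmbientForm.

(** * The unit normal vector *)

Lemma gram_col_mx (R : comNzRingType) m1 m2 q (A : 'M[R]_(m1, q)) (C : 'M[R]_(m2, q)) S :
  col_mx A C *m S *m (col_mx A C)^T =
  block_mx (A *m S *m A^T) (A *m S *m C^T) (C *m S *m A^T) (C *m S *m C^T).
Proof. by rewrite tr_col_mx mul_col_mx mul_col_row. Qed.

Section UnitNormal.
Variables (R : realType) (n : nat) (c : R).
Implicit Types (p v y z : 'rV[R]_n.+2) (T : 'M[R]_(n, n.+2)).
Local Notation E := (diag_mx (ambient_signs n c)).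
Local Notation "<[ x , y ]>" := (ambient_form c x y).

(** The square matrix whose determinant defines the normal vector. *)
Definition completion v p T : 'M[R]_n.+2 := col_mx v (col_mx p T).

(** The generalized cross product of [p] and the rows of [T]: the vector that
    represents [v |-> det (v, p, T)] for the ambient form. *)
Definition normal_vector p T : 'rV[R]_n.+2 :=
  \row_j (ambient_signs n c 0 j * cofactor (completion 0 p T) ord0 j).

Definition unit_normal p T : 'rV[R]_n.+2 :=
  (Num.sqrt <[normal_vector p T, normal_vector p T]>)^-1 *: normal_vector p T.

Lemma ambient_signs_sqr j : ambient_signs n c 0 j * ambient_signs n c 0 j = 1.
Proof. by rewrite !mxE; case: ifP => _; rewrite ?mulrNN mulr1. Qed.

Lemma completion_ord0 v p T j : completion v p T ord0 j = v 0 j.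
Proof. by rewrite /completion mxE; case: splitP => // k _; rewrite ord1. Qed.

Lemma completion_lift0 v p T i j :
  completion v p T (lift ord0 i) j = completion 0 p T (lift ord0 i) j.
Proof.
rewrite /completion !(@mxE _ (1 + (1 + n))); case: splitP => [k /=|k _ //].
by rewrite ord1.
Qed.

Lemma normal_vectorE p T v : <[normal_vector p T, v]> = \det (completion v p T).
Proof.
rewrite (expand_det_row _ ord0) ambient_formE mxform_diag.
apply: eq_bigr => j _; have drop_sign (a b d : R) : a * a = 1 -> a * (a * b * d) = d * b.
  by move=> aa; rewrite -!mulrA mulrA aa mul1r mulrC.
rewrite [normal_vector _ _ _ _]mxE (drop_sign _ _ _ (ambient_signs_sqr j)).
rewrite completion_ord0; congr (_ * _).
rewrite /cofactor; congr (_ * \det _); apply/matrixP => i k.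
by do 2!rewrite [LHS]mxE [RHS]mxE; rewrite (completion_lift0 v).
Qed.

Section Nondegenerate.
Variables (p : 'rV[R]_n.+2) (T : 'M[R]_(n, n.+2)).
Hypothesis pp : <[p, p]> != 0.
Hypothesis pT : forall k, <[p, row k T]> = 0.
Hypothesis pos : forall v, v != 0 -> <[p, v]> = 0 -> 0 < <[v, v]>.
Hypothesis Tfree : row_free T.

Let G := T *m E *m T^T.

Lemma tangent_gram_posdef : posdef G.
Proof.
split; first by rewrite !trmx_mul trmxK tr_diag_mx mulmxA.
move=> v v0.
have vT0 : v *m T != 0.
  apply: contra v0 => /eqP vT; apply/eqP/(row_free_inj Tfree).
  by rewrite vT mul0mx.
have -> : (v *m G *m v^T) 0 0 = <[v *m T, v *m T]>.
  by rewrite ambient_formE mxform_mul.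
apply: pos => //; rewrite ambient_formE /mxform trmx_mul mulmxA.
suff -> : p *m E *m T^T = 0 by rewrite mul0mx mxE.
by apply/rowP => k; rewrite ambient_form_mxE mxE row_id pT.
Qed.

(** The Gram determinant of the rows of [completion v p T], which is block
    diagonal when [v] is orthogonal to the other rows. *)
Lemma completion_gram v : <[v, p]> = 0 -> (forall k, <[v, row k T]> = 0) ->
  \det (completion v p T) ^+ 2 * \det E = <[v, v]> * (<[p, p]> * \det G).
Proof.
move=> vp vT.
have -> : \det (completion v p T) ^+ 2 * \det E =
    \det (completion v p T *m E *m (completion v p T)^T).
  by rewrite !det_mulmx det_tr expr2 mulrAC.
have orth (A : 'M[R]_(1, n.+2)) m (C : 'M[R]_(m, n.+2)) :
    (forall k, <[A, row k C]> = 0) -> A *m E *m C^T = 0.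
  by move=> A0; apply/matrixP => i k; rewrite ord1 ambient_form_mxE mxE row_id A0.
have sq (A : 'M[R]_(1, n.+2)) : A *m E *m A^T = <[A, A]>%:M.
  by rewrite ambient_formE [LHS]mx11_scalar.
have trE m1 m2 (A : 'M[R]_(m1, n.+2)) (C : 'M[R]_(m2, n.+2)) : (A *m E *m C^T)^T = C *m E *m A^T.
  by rewrite !trmx_mul trmxK tr_diag_mx mulmxA.
have vB : v *m E *m (col_mx p T)^T = 0.
  rewrite tr_col_mx mul_mx_row !orth ?row_mx0// => k; rewrite ?vT// row_id ?vp//.
rewrite [completion v p T *m E *m _](gram_col_mx v (col_mx p T) E) vB.
have pT0 : p *m E *m T^T = 0 by apply: orth.
rewrite (@det_lblock _ 1 (1 + n)) (gram_col_mx p T E) pT0.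
rewrite (@det_lblock _ 1 n).
by rewrite !sq !det_scalar1.
Qed.

(** A vector orthogonal to [p] and to the rows of [T] exists for dimension
    reasons; its Gram determinant is nonzero, so the cross product does not vanish.
    The latter is spacelike because it is orthogonal to [p]. *)
Lemma normal_vector_spec :
  [/\ 0 < <[normal_vector p T, normal_vector p T]>, <[normal_vector p T, p]> = 0
    & forall k, <[normal_vector p T, row k T]> = 0].
Proof.
set Nt := normal_vector p T.
have Np : <[Nt, p]> = 0.
  rewrite normal_vectorE.
  apply: (@determinant_alternate _ _ _ ord0 (@rshift 1 (1 + n) (@lshift 1 n ord0))) => // j.
  by rewrite completion_ord0 (col_mxEd p (col_mx p T)) (col_mxEu p T).
have NT k : <[Nt, row k T]> = 0.
  rewrite normal_vectorE.
  apply: (@determinant_alternate _ _ _ ord0 (@rshift 1 (1 + n) (@rshift 1 n k))) => // j.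
  by rewrite completion_ord0 (col_mxEd (row k T) (col_mx p T)) (col_mxEd p T) mxE.
have NN : 0 < <[Nt, Nt]>.
  have [w w0 [wp wT]] : exists2 w, w != 0 & <[w, p]> = 0 /\ forall k, <[w, row k T]> = 0.
    pose M : 'M[R]_(n.+2, 1 + n) := E *m (col_mx p T)^T.
    pose w := nz_row (kermx M); exists w.
      rewrite nz_row_eq0 kermx_eq0 /row_free neq_ltn.
      by rewrite (leq_ltn_trans (rank_leq_col M)).
    have /sub_kermxP wM : (w <= kermx M)%MS := nz_row_sub _.
    have wrow i : <[w, row i (col_mx p T)]> = 0.
      rewrite -(row_id ord0 w) -ambient_form_mxE -mulmxA.
      by have /matrixP/(_ 0 i) := wM; rewrite !mxE.
    split=> [|k]; first by have := wrow (lshift n ord0); rewrite rowKu row_id.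
    by have := wrow (rshift 1 k); rewrite rowKd.
  apply: pos; last by rewrite ambient_formC.
  apply/eqP => Nt0; have := completion_gram wp wT.
  rewrite -normal_vectorE -/Nt Nt0 -[0](scale0r 0) ambient_formZl mul0r expr0n mul0r => /esym/eqP.
  rewrite !mulf_eq0 (negPf pp) gt_eqF/= ?pos 1?ambient_formC//.
  by apply/negP; rewrite -unitfE -unitmxE; exact: posdef_unit tangent_gram_posdef.
by [].
Qed.

Lemma unit_normal_spec :
  [/\ <[unit_normal p T, unit_normal p T]> = 1, <[unit_normal p T, p]> = 0
    & forall k, <[unit_normal p T, row k T]> = 0].
Proof.
have [NN Np NT] := normal_vector_spec.
pose Nt := normal_vector p T; rewrite -/Nt in NN Np NT.
have s0 : Num.sqrt <[Nt, Nt]> != 0 by rewrite gt_eqF ?sqrtr_gt0.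
rewrite /unit_normal -/Nt; split=> [|| k]; rewrite ambient_formZl.
- rewrite ambient_formC ambient_formZl -{3}[<[Nt, Nt]>]sqr_sqrtr ?ltW//.
  by field.
- by rewrite Np mulr0.
- by rewrite NT mulr0.
Qed.

(** Expansion of [y] and [z] in the basis formed by the tangent vectors, [p] and
    the unit normal: the left-hand side is the form of their components normal to
    the rows of [T]. *)
Lemma normal_expansion y z :
  <[y, z]> - ((y *m E *m T^T) *m invmx G *m (z *m E *m T^T)^T) 0 0 =
    <[y, p]> * <[z, p]> / <[p, p]>
    + <[y, unit_normal p T]> * <[z, unit_normal p T]>.
Proof.
move: unit_normal_spec; move: (unit_normal p T) => N [NN Np NT].
pose b (w : 'rV[R]_n.+2) := w *m E *m T^T; rewrite -/(b y) -/(b z).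
have Gu := posdef_unit tangent_gram_posdef.
have Bu : completion N p T \in unitmx.
  rewrite unitmxE unitfE; apply/eqP => B0; have := completion_gram Np NT.
  rewrite B0 expr0n mul0r NN mul1r => /esym/eqP; rewrite mulf_eq0 (negPf pp) /=.
  by apply/negP; rewrite -unitfE -unitmxE.
have [s [a [t yE]]] : exists (s a : R) (t : 'rV[R]_n), y = s *: N + (a *: p + t *m T).
  pose u : 'M[R]_(1, 1 + (1 + n)) := y *m invmx (completion N p T).
  exists (lsubmx u 0 0), (lsubmx (rsubmx u) 0 0), (rsubmx (rsubmx u)).
  rewrite -!mul_scalar_mx -!mx11_scalar -mul_row_col hsubmxK -mul_row_col hsubmxK.
  by rewrite /u mulmxKV.
have bN : b N = 0 by apply/rowP => k; rewrite ambient_form_mxE mxE row_id NT.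
have bp : b p = 0 by apply/rowP => k; rewrite ambient_form_mxE mxE row_id pT.
have by_ : b y = t *m G.
  have bD w : b (s *: N + (a *: p + w)) = s *: b N + (a *: b p + b w).
    by rewrite /b !mulmxDl -!scalemxAl.
  by rewrite yE bD bN bp !scaler0 !add0r /b /G !mulmxA.
have tz : <[t *m T, z]> = (t *m (b z)^T) 0 0.
  by rewrite ambient_formE /mxform /b !trmx_mul trmxK tr_diag_mx !mulmxA.
have tN (w : 'rV[R]_n.+2) : (forall k, <[w, row k T]> = 0) -> <[t *m T, w]> = 0.
  move=> wT; rewrite ambient_formC ambient_formE /mxform trmx_mul mulmxA.
  suff -> : w *m E *m T^T = 0 by rewrite mul0mx mxE.
  by apply/rowP => k; rewrite ambient_form_mxE mxE row_id wT.
rewrite by_ mulmxK// yE !ambient_formDl !ambient_formZl tz (tN N NT) (tN p pT) NN Np.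
rewrite [<[p, N]>]ambient_formC Np [<[N, z]>]ambient_formC [<[p, z]>]ambient_formC.
by field.
Qed.

(** This compares the unit normals that two charts define at the same point. *)
Lemma unit_normal_unique M :
  <[M, M]> = 1 -> <[M, p]> = 0 -> (forall k, <[M, row k T]> = 0) ->
  exists2 e : R, e * e = 1 & forall y, <[y, M]> = e * <[y, unit_normal p T]>.
Proof.
move=> MM Mp MT; exists <[M, unit_normal p T]>.
  have := normal_expansion M M.
  have -> : M *m E *m T^T = 0 by apply/rowP => k; rewrite ambient_form_mxE mxE row_id MT.
  by rewrite !mul0mx mxE subr0 MM Mp !mul0r add0r => <-.
move=> y; have := normal_expansion y M.
have -> : M *m E *m T^T = 0 by apply/rowP => k; rewrite ambient_form_mxE mxE row_id MT.
by rewrite trmx0 mulmx0 mxE subr0 Mp mulr0 mul0r add0r mulrC.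
Qed.

End Nondegenerate.

Lemma continuous_unit_normal (S : topologicalType) (p : S -> 'rV[R]_n.+2)
    (T : S -> 'M[R]_(n, n.+2)) (x : S) :
  (forall a, {for x, continuous (fun q : S => p q 0 a)}) ->
  (forall k a, {for x, continuous (fun q : S => T q k a)}) ->
  0 < <[normal_vector (p x) (T x), normal_vector (p x) (T x)]> ->
  forall a, {for x, continuous (fun q : S => unit_normal (p q) (T q) 0 a)}.
Proof.
move=> pc Tc N0.
have Nc a : {for x, continuous (fun q : S => normal_vector (p q) (T q) 0 a)}.
  have -> : (fun q : S => normal_vector (p q) (T q) 0 a) = (fun q =>
      ambient_signs n c 0 a * ((-1) ^+ (@ord0 n.+1 + a) *
      \det (row' ord0 (col' a (completion 0 (p q) (T q)))))).
    by apply/funext => q; rewrite mxE.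
  apply: cvgM; first exact: cvg_cst.
  apply: cvgM; first exact: cvg_cst.
  apply: (@det_closed _ _ (fun f : S -> R => {for x, continuous f})).
  - by move=> b; exact: cvg_cst.
  - by move=> f g fc gc; exact: cvgD.
  - by move=> f g fc gc; exact: cvgM.
  move=> i j.
  have [u uE|u uE] := splitP (lift ord0 i : 'I_(1 + (1 + n))).
    by move: uE; rewrite ord1.
  have -> : (fun q : S => row' ord0 (col' a (completion 0 (p q) (T q))) i j) =
      (fun q => col_mx (p q) (T q) u (lift a j)).
    apply/funext => q; do 2!rewrite [LHS]mxE.
    have -> : lift ord0 i = @rshift 1 (1 + n) u by exact: val_inj.
    exact: (col_mxEd 0 (col_mx (p q) (T q))).
  have [k kE|k kE] := splitP (u : 'I_(1 + n)).
    have -> : (fun q => col_mx (p q) (T q) u (lift a j)) = (fun q => p q 0 (lift a j)).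
      apply/funext => q; have -> : u = @lshift 1 n k by exact: val_inj.
      by rewrite (col_mxEu (p q) (T q)) ord1.
    exact: pc.
  have -> : (fun q => col_mx (p q) (T q) u (lift a j)) = (fun q => T q k (lift a j)).
    apply/funext => q; have -> : u = @rshift 1 n k by exact: val_inj.
    exact: (col_mxEd (p q) (T q)).
  exact: Tc.
move=> a.
have -> : (fun q : S => unit_normal (p q) (T q) 0 a) = (fun q =>
   (Num.sqrt <[normal_vector (p q) (T q), normal_vector (p q) (T q)]>)^-1 *
   normal_vector (p q) (T q) 0 a).
  by apply/funext => q; rewrite mxE.
apply: cvgM; last exact: Nc.
apply: cvgV; first by rewrite gt_eqF ?sqrtr_gt0.
pose norm2 (q : S) := <[normal_vector (p q) (T q), normal_vector (p q) (T q)]>.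
apply: (@continuous_comp _ _ _ norm2 Num.sqrt).
  exact: continuous_ambient_form.
exact: sqrt_continuous.
Qed.

End UnitNormal.

(** * Space forms *)

(** A normal vector to the space form in the flat ambient space: the position
    vector for the sphere and the hyperboloid, the vector [e_0] for the hyperplane.
    It lets the three models be treated alike. *)
Definition polar_vector (R : realType) n (c : R) (x : 'rV[R]_n.+2) : 'rV[R]_n.+2 :=
  if c == 0 then delta_mx 0 ord0 else x.

Lemma ambient_form_euclidean (R : realType) n (c : R) (v : 'rV[R]_n.+2) :
  0 <= c -> v != 0 -> 0 < ambient_form c v v.
Proof.
move=> c0 v0; have vE : ambient_form c v v = \sum_i v 0 i ^+ 2.
  by apply: eq_bigr => i _; rewrite ltNge c0 /= mul1r expr2.
rewrite vE lt_neqAle sumr_ge0 ?andbT => [|i _]; last exact: sqr_ge0.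
rewrite eq_sym; apply: contra v0; rewrite psumr_eq0 => [/allP H|i _]; last exact: sqr_ge0.
apply/eqP/rowP => i; apply/eqP; rewrite mxE -sqrf_eq0.
by have := H i; rewrite mem_index_enum => /(_ isT).
Qed.

Lemma cauchy_schwarz_sum (R : realFieldType) n (u v : 'I_n -> R) :
  (\sum_i u i * v i) ^+ 2 <= (\sum_i u i ^+ 2) * (\sum_i v i ^+ 2).
Proof.
set D := \sum_i u i * v i; set Q := \sum_i u i ^+ 2; set S := \sum_i v i ^+ 2.
have S0 : 0 <= S by apply: sumr_ge0 => i _; exact: sqr_ge0.
have : 0 <= S * (S * Q - D ^+ 2).
  have <- : \sum_i (S * u i - D * v i) ^+ 2 = S * (S * Q - D ^+ 2).
    transitivity (\sum_i (S ^+ 2 * u i ^+ 2 - 2 * S * D * (u i * v i) + D ^+ 2 * v i ^+ 2)).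
      by apply: eq_bigr => i _; ring.
    rewrite big_split sumrB /= -!mulr_sumr -/D -/Q -/S; ring.
  by apply: sumr_ge0 => i _; exact: sqr_ge0.
move: S0; rewrite le_eqVlt => /orP[/eqP S0 _|S0].
  have v0 i : v i = 0.
    apply/eqP; rewrite -sqrf_eq0; move/esym/eqP: S0; rewrite psumr_eq0.
      by move=> /allP/(_ i); rewrite mem_index_enum => /(_ isT).
    by move=> j _; exact: sqr_ge0.
  by rewrite /D big1 ?expr0n -?S0 ?mulr0 // => i _; rewrite v0 mulr0.
by rewrite pmulr_rge0// subr_ge0 mulrC.
Qed.

(** For [c < 0] this is the reversed Cauchy-Schwarz inequality: the orthogonal
    of a timelike vector is spacelike. *)
Lemma polar_orthogonal_pos (R : realType) n (c : R) (x v : 'rV[R]_n.+2) :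
  space_form c x -> v != 0 -> ambient_form c (polar_vector c x) v = 0 ->
  0 < ambient_form c v v.
Proof.
rewrite /space_form /polar_vector /=; have [c0|c0 sx] := eqVneq c 0.
  by move=> _ v0 _; apply: ambient_form_euclidean; rewrite ?c0.
move=> v0 xv; have [cp|cn] := leP 0 c; first exact: ambient_form_euclidean.
have [xx /(_ cn) x00] := sx.
have E (y z : 'rV[R]_n.+2) : ambient_form c y z =
    - (y 0 ord0 * z 0 ord0) + \sum_(i < n.+1) y 0 (lift ord0 i) * z 0 (lift ord0 i).
  rewrite /ambient_form big_ord_recl cn eqxx /= !mulN1r mulNr; congr (_ + _).
  by apply: eq_bigr => i _; rewrite mul1r.
have CS := cauchy_schwarz_sum (fun i : 'I_n.+1 => x 0 (lift ord0 i))
                              (fun i => v 0 (lift ord0 i)).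
have sqE (y : 'rV[R]_n.+2) : \sum_(i < n.+1) y 0 (lift ord0 i) * y 0 (lift ord0 i) =
    \sum_(i < n.+1) y 0 (lift ord0 i) ^+ 2.
  by apply: eq_bigr => i _; rewrite expr2.
have S0 : 0 <= \sum_(i < n.+1) v 0 (lift ord0 i) ^+ 2.
  by apply: sumr_ge0 => i _; exact: sqr_ge0.
have ic : c^-1 < 0 by rewrite invr_lt0.
move: xx xv; rewrite !E !sqE.
set D := \sum_i _ in CS *; set Q := \sum_i x 0 _ ^+ 2 in CS *.
set S := \sum_i v 0 _ ^+ 2 in S0 CS * => xx xv.
have DE : D = x 0 ord0 * v 0 ord0 by lra.
have QE : Q = x 0 ord0 ^+ 2 + c^-1 by rewrite expr2; lra.
have x0 : 0 < x 0 ord0 ^+ 2 by rewrite exprn_gt0.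
rewrite DE QE in CS.
have [Sz|Sn] := eqVneq S 0.
  have v00 : v 0 ord0 = 0.
    rewrite Sz mulr0 in CS; apply/eqP; rewrite -sqrf_eq0 eq_le sqr_ge0 andbT.
    by rewrite -(pmulr_rle0 _ x0) -exprMn.
  case/eqP: v0; apply/rowP => i; rewrite mxE.
  have [j ->|->//] := unliftP ord0 i.
  apply/eqP; rewrite -sqrf_eq0; move/eqP: Sz; rewrite psumr_eq0.
    by move=> /allP/(_ j); rewrite mem_index_enum => /(_ isT).
  by move=> k _; exact: sqr_ge0.
have Sp : 0 < S by rewrite lt_neqAle eq_sym Sn.
have : x 0 ord0 ^+ 2 * v 0 ord0 ^+ 2 < x 0 ord0 ^+ 2 * S.
  rewrite -exprMn; apply: le_lt_trans CS _.
  by rewrite ltr_pM2r// gtrDl.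
by rewrite ltr_pM2l// expr2; lra.
Qed.

Lemma polar_norm (R : realType) n (c : R) (x : 'rV[R]_n.+2) : space_form c x ->
  ambient_form c (polar_vector c x) (polar_vector c x) != 0 /\
  c ^+ 2 * ambient_form c (polar_vector c x) (polar_vector c x) = c.
Proof.
rewrite /space_form /polar_vector /=; have [c0 _|c0 [-> _]] := eqVneq c 0.
  split; last by rewrite c0 expr0n mul0r.
  rewrite gt_eqF// ambient_form_euclidean ?c0//.
  by apply/eqP => /matrixP/(_ 0 ord0)/eqP; rewrite !mxE !eqxx oner_eq0.
by split; [rewrite invr_eq0|field].
Qed.

(** * The Gauss equation *)

(** By the formula of Cramer. *)
Lemma derivable_invmx (R : realType) (V : normedModType R) n (A : V -> 'M[R]_n)
    (U : set V) (x v : V) k l : open U -> U x -> (forall y, U y -> A y \in unitmx) ->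
  (forall i j, derivable (fun y => A y i j) x v) ->
  derivable (fun y => invmx (A y) k l) x v.
Proof.
move=> Uo Ux Au dA.
have det_derivable m (B : V -> 'M[R]_m) : (forall i j, derivable (fun y => B y i j) x v) ->
    derivable (fun y => \det (B y)) x v.
  apply: (@det_closed _ _ (fun f : V -> R => derivable f x v)).
  - by move=> b; exact: derivable_cst.
  - by move=> f1 f2; exact: (@derivableD _ _ _ f1 f2).
  - by move=> f1 f2; exact: (@derivableM _ _ f1 f2).
apply: (@near_eq_derivable _ _ _ (fun y => (\det (A y))^-1 *
    ((-1) ^+ (l + k) * \det (row' l (col' k (A y)))))).
  near=> y; rewrite /invmx ifT; last by apply: Au; near: y; exact: open_nbhs_nbhs.
  by rewrite !mxE.
apply: (@derivableM _ _ (fun y => (\det (A y))^-1)).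
  apply: derivableV; last exact: det_derivable.
  by rewrite -unitfE -unitmxE; exact: Au.
apply: (@derivableM _ _ (fun=> _)); first exact: derivable_cst.
apply: det_derivable => i j.
by under eq_fun do rewrite !mxE; exact: dA.
Unshelve. all: by end_near. Qed.

Lemma pderive_val (R : realType) n (f : 'rV[R]_n -> R) x i d :
  is_derive x (delta_mx 0 i) f d -> pderive i (f : _ -> R^o) x = d.
Proof. by case. Qed.

Lemma is_derive_pderive (R : realType) n (f : 'rV[R]_n -> R) x i :
  derivable f x (delta_mx 0 i) -> is_derive x (delta_mx 0 i) f (pderive i (f : _ -> R^o) x).
Proof. by move=> df; exact: derivableP. Qed.

Lemma ambient_form_e0 (R : realType) n (c : R) (y : 'rV[R]_n.+2) :
  c = 0 -> ambient_form c (delta_mx 0 ord0) y = y 0 ord0.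
Proof.
move=> c0; rewrite /ambient_form big_ord_recl big1 ?addr0 => [|l _].
  by rewrite c0 ltxx /= !mxE eqxx mulr1n !mul1r.
by rewrite !mxE /= mulr0 mul0r.
Qed.

Lemma christoffel_half (R : fieldType) (v a b d : R) : (2 : R) != 0 ->
  2^-1 * (v * (a + b + (a + d) - (b + d))) = v * a.
Proof. by move=> ?; field. Qed.

Section Multilinear.
Variables (R : realType) (n : nat).
Implicit Types (t : 'I_n -> 'I_n -> 'I_n -> 'I_n -> R) (u v w z : 'rV[R]_n) (A B : 'M[R]_n).

Definition multilinear4 t u v w z :=
  \sum_i \sum_j \sum_k \sum_m u 0 i * v 0 j * w 0 k * z 0 m * t i j k m.

Lemma eq_multilinear4 t t' u v w z : (forall i j k m, t i j k m = t' i j k m) ->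
  multilinear4 t u v w z = multilinear4 t' u v w z.
Proof. by move=> tt'; do 4!apply: eq_bigr => ? _; rewrite tt'. Qed.

Lemma multilinear4D t t' u v w z :
  multilinear4 (fun i j k m => t i j k m + t' i j k m) u v w z =
  multilinear4 t u v w z + multilinear4 t' u v w z.
Proof.
do 4!(rewrite -big_split; apply: eq_bigr => ? _).
by rewrite mulrDr.
Qed.

Lemma multilinear4Z a t u v w z :
  multilinear4 (fun i j k m => a * t i j k m) u v w z = a * multilinear4 t u v w z.
Proof.
do 4!(rewrite mulr_sumr; apply: eq_bigr => ? _).
by rewrite mulrCA.
Qed.

Lemma multilinear4B t t' u v w z :
  multilinear4 (fun i j k m => t i j k m - t' i j k m) u v w z =
  multilinear4 t u v w z - multilinear4 t' u v w z.
Proof.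
do 4!(rewrite -sumrB; apply: eq_bigr => ? _).
by rewrite mulrBr.
Qed.

(** With [multilinear4_cross], the two products of bilinear forms in the Gauss
    equation as multilinear forms. *)
Lemma multilinear4_nest A B u v w z :
  mxform A v w * mxform B u z = multilinear4 (fun i j k m => A j k * B i m) u v w z.
Proof.
rewrite /multilinear4 exchange_big !mxformE mulr_suml; apply: eq_bigr => j _ /=.
rewrite [RHS]exchange_big mulr_suml; apply: eq_bigr => k _ /=.
rewrite mulr_sumr; apply: eq_bigr => i _; rewrite mulr_sumr; apply: eq_bigr => m _.
by ring.
Qed.

Lemma multilinear4_cross A B u v w z :
  mxform A u w * mxform B v z = multilinear4 (fun i j k m => A i k * B j m) u v w z.
Proof.
rewrite /multilinear4 !mxformE mulr_suml; apply: eq_bigr => i _ /=.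
rewrite [RHS]exchange_big mulr_suml; apply: eq_bigr => k _ /=.
rewrite mulr_sumr; apply: eq_bigr => j _; rewrite mulr_sumr; apply: eq_bigr => m _.
by ring.
Qed.

Lemma riemann_at_multilinear4 (g : metric_coef R n) x u v w z :
  riemann_at g x u v w z = multilinear4 (fun i j k m =>
    \sum_l riemann_coef g i j k l x * g x l m) u v w z.
Proof.
have swap3 (f : 'I_n -> 'I_n -> 'I_n -> R) :
    \sum_l \sum_m \sum_i f l m i = \sum_i \sum_l \sum_m f l m i.
  rewrite [RHS]exchange_big; apply: eq_bigr => l _ /=.
  by rewrite exchange_big.
rewrite /riemann_at metric_at_mxform mxformE.
transitivity (\sum_l \sum_m \sum_i \sum_j \sum_k
    u 0 i * v 0 j * w 0 k * riemann_coef g i j k l x * (z 0 m * g x l m)).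
  apply: eq_bigr => l _; apply: eq_bigr => m _; rewrite mxE -mulrA.
  by do 3!(rewrite mulr_suml; apply: eq_bigr => ? _).
rewrite swap3; apply: eq_bigr => i _; rewrite swap3; apply: eq_bigr => j _.
rewrite swap3; apply: eq_bigr => k _; rewrite exchange_big; apply: eq_bigr => m _ /=.
rewrite mulr_sumr; apply: eq_bigr => l _.
by move: (riemann_coef _ _ _ _ _ _) => r; ring.
Qed.

End Multilinear.

Definition coord_partial (R : realType) n m (U : set 'rV[R]_n) (i : 'I_n)
    (X X' : 'rV[R]_n -> 'rV[R]_m) :=
  forall x a, U x -> is_derive x (delta_mx 0 i) (fun y => X y 0 a) (X' x 0 a).

Definition coord_continuous_on (R : realType) n m (U : set 'rV[R]_n) (X : 'rV[R]_n -> 'rV[R]_m) :=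
  forall x a, U x -> {for x, continuous (fun y => X y 0 a)}.

Definition tangent_frame (R : realType) n (F1 : 'I_n -> 'rV[R]_n -> 'rV[R]_n.+2) x :
    'M[R]_(n, n.+2) :=
  \matrix_(k < n) F1 k x.

(** The partial derivatives up to order three of a coordinate expression [F] of
    the immersion, kept as abstract functions: [F1 i], [F2 i j] and [F3 i j k] stand
    for the derivatives along [d_i], [d_i d_j] and [d_i d_j d_k]. *)
Record hypersurface_jet (R : realType) n (c : R) (U : set 'rV[R]_n)
    (F : 'rV[R]_n -> 'rV[R]_n.+2) (F1 : 'I_n -> 'rV[R]_n -> 'rV[R]_n.+2)
    (F2 : 'I_n -> 'I_n -> 'rV[R]_n -> 'rV[R]_n.+2)
    (F3 : 'I_n -> 'I_n -> 'I_n -> 'rV[R]_n -> 'rV[R]_n.+2) : Prop := HypersurfaceJet {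
  jet_open : open U;
  jet_partial1 : forall i, coord_partial U i F (F1 i);
  jet_partial2 : forall i j, coord_partial U i (F1 j) (F2 i j);
  jet_partial3 : forall i j k, coord_partial U i (F2 j k) (F3 i j k);
  jet_continuous0 : coord_continuous_on U F;
  jet_continuous1 : forall i, coord_continuous_on U (F1 i);
  jet_continuous2 : forall i j, coord_continuous_on U (F2 i j);
  jet_sym2 : forall i j x, U x -> F2 i j x = F2 j i x;
  jet_sym3 : forall i j k x, U x -> F3 i j k x = F3 j i k x;
  jet_space_form : forall x, U x -> space_form c (F x);
  jet_immersion : forall x, U x -> row_free (tangent_frame F1 x)
}.

Section Hypersurface.
Variables (R : realType) (n : nat) (c : R).
Variables (F : 'rV[R]_n -> 'rV[R]_n.+2) (F1 : 'I_n -> 'rV[R]_n -> 'rV[R]_n.+2).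
Variables (F2 : 'I_n -> 'I_n -> 'rV[R]_n -> 'rV[R]_n.+2).
Variables (F3 : 'I_n -> 'I_n -> 'I_n -> 'rV[R]_n -> 'rV[R]_n.+2).
Variable U : set 'rV[R]_n.
Hypothesis jet : hypersurface_jet c U F F1 F2 F3.

Let Uo := jet_open jet.
Let dF := jet_partial1 jet.
Let dF1 := jet_partial2 jet.
Let dF2 := jet_partial3 jet.
Let F2C := jet_sym2 jet.
Let F3C := jet_sym3 jet.
Let Fsf := jet_space_form jet.
Let Fr := jet_immersion jet.

Local Notation E := (diag_mx (ambient_signs n c)).
Local Notation "<[ x , y ]>" := (ambient_form c x y).

Definition pullback_metric : metric_coef R n :=
  fun x => \matrix_(k, l) <[F1 k x, F1 l x]>.
Definition normal_at x := unit_normal c (polar_vector c (F x)) (tangent_frame F1 x).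
Definition second_fundamental_form x : 'M[R]_n :=
  \matrix_(i, j) <[F2 i j x, normal_at x]>.
Local Notation T := (tangent_frame F1).
Local Notation g := pullback_metric.
Local Notation N := normal_at.
Local Notation h := second_fundamental_form.
Local Notation p x := (polar_vector c (F x)).

Lemma row_tangent_frame x k : row k (T x) = F1 k x.
Proof. by rewrite rowK. Qed.

Lemma tangent_gramE x : T x *m E *m (T x)^T = g x.
Proof. by apply/matrixP => k l; rewrite ambient_form_mxE !row_tangent_frame mxE. Qed.

Lemma is_derive_form (X Y X' Y' : 'rV[R]_n -> 'rV[R]_n.+2) x i : U x ->
  coord_partial U i X X' -> coord_partial U i Y Y' ->
  is_derive x (delta_mx 0 i) (fun y => <[X y, Y y]>) (<[X' x, Y x]> + <[X x, Y' x]>).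
Proof.
by move=> Ux dX dY; apply: is_derive_ambient_form => a; [exact: dX | exact: dY].
Qed.

Lemma polar_tangent x k : U x -> <[p x, F1 k x]> = 0.
Proof.
move=> Ux; rewrite /polar_vector; have [c0|c0] := eqVneq c 0.
  have Fz y : U y -> F y 0 ord0 = 0.
    by move=> /Fsf; rewrite /space_form /= c0 eqxx.
  have F1z := is_derive_const_on Uo Ux Fz (dF k ord0 Ux).
  by rewrite ambient_form_e0.
have FF y : U y -> <[F y, F y]> = c^-1.
  by move=> /Fsf; rewrite /space_form /= (negPf c0) => -[].
have := is_derive_const_on Uo Ux FF (is_derive_form Ux (dF k) (dF k)).
rewrite [X in X + _]ambient_formC => /eqP.
by rewrite -mulr2n -mulr_natr mulf_eq0 pnatr_eq0 orbF => /eqP.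
Qed.

(** Differentiating twice the equation of the space form.  The second
    derivatives of the immersion have the component [- c g_ij] along the polar
    vector, which is the term of constant curvature in the Gauss equation. *)
Lemma polar_second x i j : U x ->
  <[F2 i j x, p x]> = - (c * <[p x, p x]> * g x i j).
Proof.
move=> Ux; rewrite mxE; have := polar_norm (Fsf Ux); rewrite /polar_vector.
have [c0 _|c0 [_ cc]] := eqVneq c 0.
  rewrite -mulrA [X in - (X * _)]c0 mul0r oppr0.
  have F1z y : U y -> F1 j y 0 ord0 = 0.
    move=> Uy; have := polar_tangent j Uy; rewrite /polar_vector c0 eqxx.
    by rewrite ambient_form_e0.
  have F2z := is_derive_const_on Uo Ux F1z (dF1 i j ord0 Ux).
  by rewrite ambient_formC ambient_form_e0.
have FF y : U y -> <[F1 j y, F y]> = 0.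
  by move=> Uy; have := polar_tangent j Uy; rewrite /polar_vector (negPf c0) ambient_formC.
have := is_derive_const_on Uo Ux FF (is_derive_form Ux (dF1 i j) (dF i)).
have -> : c * <[F x, F x]> = 1.
  by apply: (mulfI c0); rewrite mulrA -expr2 cc mulr1.
rewrite mul1r [<[F1 j x, F1 i x]>]ambient_formC => /eqP; rewrite addr_eq0 => /eqP.
exact.
Qed.

Section AtPoint.
Variable x : 'rV[R]_n.
Hypothesis Ux : U x.

Let pp : <[p x, p x]> != 0. Proof. by case: (polar_norm (Fsf Ux)). Qed.
Let pT k : <[p x, row k (T x)]> = 0.
Proof. by rewrite row_tangent_frame polar_tangent. Qed.
Let pos v : v != 0 -> <[p x, v]> = 0 -> 0 < <[v, v]>.
Proof. exact: polar_orthogonal_pos (Fsf Ux). Qed.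

Lemma pullback_metric_posdef : posdef (g x).
Proof. by rewrite -tangent_gramE; exact: tangent_gram_posdef pT pos (Fr Ux). Qed.

Lemma normal_at_spec : [/\ <[N x, N x]> = 1, <[N x, p x]> = 0 & forall k, <[N x, F1 k x]> = 0].
Proof.
have [NN Np NT] := unit_normal_spec pp pT pos (Fr Ux); split=> // k.
by rewrite -row_tangent_frame.
Qed.

Lemma normal_at_unique M :
  <[M, M]> = 1 -> <[M, p x]> = 0 -> (forall k, <[M, F1 k x]> = 0) ->
  exists2 e : R, e * e = 1 & forall y, <[y, M]> = e * <[y, N x]>.
Proof.
move=> MM Mp MT; apply: (unit_normal_unique pp pT pos (Fr Ux) MM Mp) => k.
by rewrite row_tangent_frame.
Qed.

Lemma second_fundamental_form_sym : (h x)^T = h x.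
Proof. by apply/matrixP => i j; rewrite !mxE (F2C i j Ux). Qed.

Lemma is_derive_metric i j l :
  is_derive x (delta_mx 0 i) (fun y => g y j l) (<[F2 i j x, F1 l x]> + <[F1 j x, F2 i l x]>).
Proof.
rewrite (_ : (fun y => g y j l) = (fun y => <[F1 j y, F1 l y]>)).
  exact: (is_derive_form Ux (dF1 i j) (dF1 i l)).
by apply/funext => y; rewrite mxE.
Qed.

(** The Koszul formula: the Christoffel symbols are the tangential components
    of the second derivatives of the immersion. *)
Lemma christoffelE i j k :
  christoffel g i j k x = \sum_l invmx (g x) k l * <[F2 i j x, F1 l x]>.
Proof.
rewrite /christoffel mulr_sumr; apply: eq_bigr => l _.
have dE a b d : pderive a (fun y => g y b d : R^o) x = <[F2 a b x, F1 d x]> + <[F1 b x, F2 a d x]>.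
  exact: (pderive_val (is_derive_metric a b d)).
rewrite !dE.
have -> : <[F2 j i x, F1 l x]> = <[F2 i j x, F1 l x]>.
  by rewrite (F2C j i Ux).
have -> : <[F2 l i x, F1 j x]> = <[F1 j x, F2 i l x]>.
  by rewrite (F2C l i Ux) ambient_formC.
have -> : <[F1 i x, F2 l j x]> = <[F1 i x, F2 j l x]>.
  by rewrite (F2C l j Ux).
by rewrite christoffel_half ?pnatr_eq0.
Qed.

Lemma christoffel_metric i j m :
  \sum_k christoffel g i j k x * g x k m = <[F2 i j x, F1 m x]>.
Proof.
pose a : 'rV[R]_n := \row_l <[F2 i j x, F1 l x]>.
have gu := posdef_unit pullback_metric_posdef.
have -> : \sum_k christoffel g i j k x * g x k m = (a *m (invmx (g x))^T *m g x) 0 m.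
  rewrite [RHS]mxE; apply: eq_bigr => k _; congr (_ * _); rewrite christoffelE [RHS]mxE.
  by apply: eq_bigr => l _; rewrite [a _ _]mxE [_^T _ _]mxE mulrC.
by rewrite trmx_inv (proj1 pullback_metric_posdef) mulmxKV// mxE.
Qed.

End AtPoint.

Lemma christoffel_derivable x i j k l : U x ->
  derivable (christoffel g j k l) x (delta_mx 0 i).
Proof.
move=> Ux.
apply: (@near_eq_derivable _ _ _ (fun y => \sum_m invmx (g y) l m * <[F2 j k y, F1 m y]>)).
  near=> y; rewrite christoffelE//; near: y; exact: open_nbhs_nbhs.
rewrite (_ : (fun y => _) = \sum_m (fun y => invmx (g y) l m * <[F2 j k y, F1 m y]>)); last first.
  by apply/funext => y; rewrite fct_sumE.
apply: derivable_sum => m; apply: (@derivableM _ _ (fun y => invmx (g y) l m)).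
  apply: (@derivable_invmx _ _ _ g U x _ l m Uo Ux).
    by move=> y /pullback_metric_posdef/posdef_unit.
  by move=> a b; have [+ _] := is_derive_metric Ux i a b.
by have [+ _] := is_derive_form Ux (dF2 i j k) (dF1 i m).
Unshelve. all: by end_near. Qed.

(** The sum of the [Gamma_jk^l F_l] is the tangential part of [d_j d_k F]. *)
Lemma tangential_product x i j k m : U x ->
  \sum_l christoffel g j k l x * <[F1 l x, F2 i m x]> =
  (F2 j k x *m E *m (T x)^T *m invmx (g x) *m (F2 i m x *m E *m (T x)^T)^T) 0 0.
Proof.
move=> Ux; rewrite [RHS]mxE; apply: eq_bigr => l _.
rewrite [X in _ = _ * X]mxE ambient_form_mxE row_tangent_frame row_id.
rewrite [<[F2 i m x, _]>]ambient_formC.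
congr (_ * _); rewrite christoffelE// mxE; apply: eq_bigr => q _.
rewrite ambient_form_mxE row_tangent_frame row_id mulrC; congr (_ * _).
have gT := proj1 (pullback_metric_posdef Ux).
by rewrite -[in LHS]gT -trmx_inv mxE.
Qed.

(** Differentiate [Gamma_bk^l g_lm = <F_bk, F_m>] along [d_a] ([key]).  In the
    curvature coefficient the third derivatives cancel by symmetry, and there
    remains the difference of the products of normal parts of second derivatives
    ([nrm]), which [normal_expansion] evaluates. *)
Lemma riemann_coef_lowered x i j k m : U x ->
  \sum_l riemann_coef g i j k l x * g x l m =
  c * (g x j k * g x i m - g x i k * g x j m) + (h x j k * h x i m - h x i k * h x j m).
Proof.
move=> Ux.
have split_sum a b : \sum_l christoffel g b k l x * (<[F2 a l x, F1 m x]> + <[F1 l x, F2 a m x]>) =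
    \sum_l christoffel g b k l x * <[F2 a l x, F1 m x]>
    + \sum_l christoffel g b k l x * <[F1 l x, F2 a m x]>.
  by rewrite -big_split; apply: eq_bigr => l _; rewrite mulrDr.
have key a b : \sum_l pderive a (christoffel g b k l : _ -> R^o) x * g x l m =
    <[F3 a b k x, F1 m x]> + <[F2 b k x, F2 a m x]>
    - (\sum_l christoffel g b k l x * <[F2 a l x, F1 m x]>
       + \sum_l christoffel g b k l x * <[F1 l x, F2 a m x]>).
  rewrite -split_sum; pose t l y := christoffel g b k l y * g y l m.
  have dt l : is_derive x (delta_mx 0 a) (t l)
     (christoffel g b k l x * (<[F2 a l x, F1 m x]> + <[F1 l x, F2 a m x]>)
      + g x l m * pderive a (christoffel g b k l : _ -> R^o) x).
    have d1 := is_derive_pderive (@christoffel_derivable x a b k l Ux).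
    have d2 := is_derive_metric Ux a l m.
    by apply: (is_derive_eq (is_deriveM d1 d2)).
  have [_ ds] := is_derive_sum dt.
  have [_ df] := is_derive_form Ux (dF2 a b k) (dF1 a m).
  have E12 : 'D_(delta_mx 0 a) (\sum_l t l) x =
             'D_(delta_mx 0 a) (fun y => <[F2 b k y, F1 m y]>) x.
    apply: near_eq_derive; near=> y; rewrite fct_sumE /t christoffel_metric//.
    by near: y; exact: open_nbhs_nbhs.
  move: E12; rewrite ds df big_split /= => <-.
  by rewrite addrC addrK; apply: eq_bigr => l _; rewrite mulrC.
have quad a b : \sum_l (\sum_q christoffel g b k q x * christoffel g a q l x) * g x l m =
    \sum_q christoffel g b k q x * <[F2 a q x, F1 m x]>.
  under eq_bigr do rewrite mulr_suml.
  rewrite exchange_big /=; apply: eq_bigr => q _.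
  rewrite -(christoffel_metric Ux) mulr_sumr.
  by apply: eq_bigr => l _; rewrite mulrA.
have nrm a b a' : <[F2 b k x, F2 a a' x]> - \sum_l christoffel g b k l x * <[F1 l x, F2 a a' x]>
    = c * (g x b k * g x a a') + h x b k * h x a a'.
  rewrite tangential_product//.
  have [pp cpp] := polar_norm (Fsf Ux).
  have pT l : <[p x, row l (T x)]> = 0 by rewrite row_tangent_frame polar_tangent.
  have := normal_expansion pp pT (fun v => polar_orthogonal_pos (Fsf Ux)) (Fr Ux)
    (F2 b k x) (F2 a a' x).
  rewrite tangent_gramE => ->.
  have hE q r : h x q r = <[F2 q r x, N x]> by rewrite mxE.
  rewrite !polar_second// !hE; congr (_ + _).
  have absorb (q y z : R) : q != 0 -> c ^+ 2 * q = c ->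
      - (c * q * y) * - (c * q * z) / q = c * (y * z).
    by move=> q0 cq; rewrite -[in RHS]cq; field.
  exact: absorb.
transitivity ((\sum_l pderive i (christoffel g j k l : _ -> R^o) x * g x l m
     + \sum_l (\sum_q christoffel g j k q x * christoffel g i q l x) * g x l m)
   - (\sum_l pderive j (christoffel g i k l : _ -> R^o) x * g x l m
     + \sum_l (\sum_q christoffel g i k q x * christoffel g j q l x) * g x l m)).
  have sumD (f1 f2 f3 f4 : 'I_n -> R) : (\sum_l f1 l + \sum_l f2 l)
      - (\sum_l f3 l + \sum_l f4 l) = \sum_l (f1 l + f2 l - (f3 l + f4 l)).
    by rewrite -!big_split -sumrB.
  rewrite sumD; apply: eq_bigr => l _.
  have dist (a b d e y : R) : (a - b + (d - e)) * y = a * y + d * y - (b * y + e * y).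
    by ring.
  by rewrite /riemann_coef sumrB dist.
refine (etrans (congr2 (fun u v : R => u - v)
  (congr2 (fun u v : R => u + v) (key i j) (quad i j))
  (congr2 (fun u v : R => u + v) (key j i) (quad j i))) _).
(* [f], [f'] are the third derivatives; [t1], [t2] cancel against the terms
   that are quadratic in the Christoffel symbols *)
have collect (f f' y1 y2 t1 t2 s1 s2 r1 r2 : R) : f = f' -> y1 - s1 = r1 -> y2 - s2 = r2 ->
    f + y1 - (t1 + s1) + t1 - (f' + y2 - (t2 + s2) + t2) = r1 - r2.
  by move=> -> <- <-; ring.
refine (etrans (collect _ _ _ _ _ _ _ _ _ _ _ (nrm i j m) (nrm j i m)) _).
  by rewrite (F3C i j k Ux).
have dist (a y d e a' z d' w : R) :
  c * (a * y) + d * e - (c * (a' * z) + d' * w) = c * (a * y - a' * z) + (d * e - d' * w).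
  by ring.
exact: dist.
Unshelve. all: by end_near. Qed.

Lemma gauss_equation_hypersurface x : U x -> gauss_equation c g x (h x).
Proof.
move=> Ux u v w z.
rewrite !(multilinear4_nest _ _ u v w z) !(multilinear4_cross _ _ u v w z).
rewrite -!multilinear4B -multilinear4Z -multilinear4D.
rewrite riemann_at_multilinear4; apply: eq_multilinear4 => i j k m.
by rewrite riemann_coef_lowered.
Qed.

Lemma continuous_metric x k l : U x -> {for x, continuous (fun y => g y k l)}.
Proof.
move=> Ux; rewrite (_ : (fun y => g y k l) = (fun y => <[F1 k y, F1 l y]>)).
  by apply: continuous_ambient_form => a; apply: jet_continuous1 jet _ _ _ Ux.
by apply/funext => y; rewrite mxE.
Qed.

Lemma continuous_normal x a : U x -> {for x, continuous (fun y => N y 0 a)}.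
Proof.
move=> Ux; apply: continuous_unit_normal.
- rewrite /polar_vector => b; have [_|_] := eqVneq c 0; first exact: cst_continuous.
  exact: (jet_continuous0 jet).
- move=> k b; rewrite (_ : (fun y => T y k b) = (fun y => F1 k y 0 b)).
    exact: (jet_continuous1 jet).
  by apply/funext => y; rewrite mxE.
- have [pp _] := polar_norm (Fsf Ux).
  have pT l : <[p x, row l (T x)]> = 0 by rewrite row_tangent_frame polar_tangent.
  by have [] := normal_vector_spec pp pT (fun v => polar_orthogonal_pos (Fsf Ux)) (Fr Ux).
Qed.

Lemma continuous_second_fundamental_form x i j : U x ->
  {for x, continuous (fun y => h y i j)}.
Proof.
move=> Ux; rewrite (_ : (fun y => h y i j) = (fun y => <[F2 i j y, N y]>)).
  apply: continuous_ambient_form => a; first exact: (jet_continuous2 jet).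
  exact: continuous_normal.
by apply/funext => y; rewrite mxE.
Qed.

End Hypersurface.

(** * Change of chart *)

Lemma is_derive_unique_on (R : realType) (V : normedModType R) (f f' : V -> R) U x v d d' :
  open U -> U x -> (forall y, U y -> f y = f' y) ->
  is_derive x v f d -> is_derive x v f' d' -> d = d'.
Proof.
move=> Uo Ux ff [_ <-] [_ <-]; apply: near_eq_derive; near=> y.
by apply: ff; near: y; exact: open_nbhs_nbhs.
Unshelve. all: by end_near. Qed.

Section ChartChange.
Variables (R : realType) (n : nat) (c : R).
Variables (F F' : 'rV[R]_n -> 'rV[R]_n.+2) (F1 F1' : 'I_n -> 'rV[R]_n -> 'rV[R]_n.+2).
Variables (F2 F2' : 'I_n -> 'I_n -> 'rV[R]_n -> 'rV[R]_n.+2).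
Variables (F3 F3' : 'I_n -> 'I_n -> 'I_n -> 'rV[R]_n -> 'rV[R]_n.+2).
Variables (U U' W : set 'rV[R]_n) (phi : 'rV[R]_n -> 'rV[R]_n).
Variables (D : 'I_n -> 'rV[R]_n -> 'rV[R]_n) (D2 : 'I_n -> 'I_n -> 'rV[R]_n -> 'rV[R]_n).
Hypothesis jet : hypersurface_jet c U F F1 F2 F3.
Hypothesis jet' : hypersurface_jet c U' F' F1' F2' F3'.
Hypothesis Wo : open W.
Hypothesis WU : W `<=` U.
Hypothesis phiW : forall y, W y -> U' (phi y).
Hypothesis Fphi : forall y, W y -> F y = F' (phi y).
Hypothesis dphi : forall i, coord_partial W i phi (D i).
Hypothesis dD : forall i j, coord_partial W i (D j) (D2 i j).

Local Notation E := (diag_mx (ambient_signs n c)).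
Local Notation "<[ x , y ]>" := (ambient_form c x y).

Lemma coord_partial_comp i (X : 'rV[R]_n -> 'rV[R]_n.+2) (X' : 'I_n -> 'rV[R]_n -> 'rV[R]_n.+2) :
  (forall a, coord_partial U' a X (X' a)) -> (forall a, coord_continuous_on U' (X' a)) ->
  forall x m, W x -> is_derive x (delta_mx 0 i) (fun y => X (phi y) 0 m)
    (\sum_a D i x 0 a * X' a (phi x) 0 m).
Proof.
move=> dX cX x m Wx.
apply: (@is_derive_chain _ _ _ (fun z => X z 0 m) (fun a z => X' a z 0 m) phi (fun a => D i x 0 a)).
- near=> z => a; apply: dX; near: z.
  by apply: open_nbhs_nbhs; split; [exact: jet_open jet'|exact: phiW].
- by move=> a; apply: cX; exact: phiW.
- by move=> a; exact: dphi.
Unshelve. all: by end_near. Qed.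

Lemma chart_change1 j y : W y -> F1 j y = \sum_a D j y 0 a *: F1' a (phi y).
Proof.
move=> Wy; apply/rowP => m; rewrite summxE.
under eq_bigr do rewrite mxE.
have dF' := coord_partial_comp j (jet_partial1 jet') (jet_continuous1 jet') m Wy.
have dF := (jet_partial1 jet : forall i, coord_partial U i F (F1 i)) j y m (WU Wy).
have FE z : W z -> F z 0 m = F' (phi z) 0 m by move=> Wz; rewrite Fphi.
exact: (is_derive_unique_on Wo Wy FE dF dF').
Qed.

(** Second order chain rule; the terms with the second derivatives [D2] of the
    change of chart are tangential. *)
Lemma chart_change2 i j x : W x -> F2 i j x =
  \sum_a (D2 i j x 0 a *: F1' a (phi x) + D j x 0 a *: \sum_b D i x 0 b *: F2' b a (phi x)).
Proof.
move=> Wx; apply/rowP => m; rewrite summxE.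
pose t a y := D j y 0 a * F1' a (phi y) 0 m.
have dt a : is_derive x (delta_mx 0 i) (t a)
    (D2 i j x 0 a * F1' a (phi x) 0 m + D j x 0 a * \sum_b D i x 0 b * F2' b a (phi x) 0 m).
  have dF1' := coord_partial_comp i (fun b => @jet_partial2 _ _ _ _ _ _ _ _ jet' b a)
    (fun b => @jet_continuous2 _ _ _ _ _ _ _ _ jet' b a) m Wx.
  apply: (is_derive_eq (is_deriveM (@dD i j x a Wx) dF1')).
  by rewrite addrC; congr (_ + _); exact: mulrC.
have ds := is_derive_sum dt.
transitivity (\sum_a (D2 i j x 0 a * F1' a (phi x) 0 m
                      + D j x 0 a * \sum_b D i x 0 b * F2' b a (phi x) 0 m)); last first.
  apply: eq_bigr => a _; rewrite !mxE summxE; congr (_ + _ * _).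
  by apply: eq_bigr => b _; rewrite mxE.
have dF1 := (jet_partial2 jet : forall i j, coord_partial U i (F1 j) (F2 i j)) i j x m (WU Wx).
have F1E z : W z -> F1 j z 0 m = (\sum_a t a) z.
  by move=> Wz; rewrite fct_sumE chart_change1// summxE; apply: eq_bigr => a _; rewrite mxE.
exact: (is_derive_unique_on Wo Wx F1E dF1 ds).
Qed.

(** Under a change of chart with Jacobian matrix [M], both fundamental forms
    transform tensorially: the terms with second derivatives are orthogonal to the
    normal.  The sign [e] compares the two choices of unit normal. *)
Lemma chart_change x : W x -> exists (M : 'M[R]_n) (e : R), [/\ e * e = 1,
  pullback_metric c F1 x = M *m pullback_metric c F1' (phi x) *m M^T &
  second_fundamental_form c F F1 F2 x =
    e *: (M *m second_fundamental_form c F' F1' F2' (phi x) *m M^T)].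
Proof.
move=> Wx; have Ux := WU Wx; have Ux' := phiW Wx.
have sumL (f : 'I_n -> 'rV[R]_n.+2) y : <[\sum_a f a, y]> = \sum_a <[f a, y]>.
  apply: (big_morph (fun z => <[z, y]>) (fun _ _ => ambient_formDl _ _ _ _)).
  by rewrite ambient_formE /mxform !mul0mx mxE.
pose M : 'M[R]_n := \matrix_(k, a) D k x 0 a.
have TE : tangent_frame F1 x = M *m tangent_frame F1' (phi x).
  apply/row_matrixP => k; rewrite rowK row_mul mulmx_sum_row chart_change1//.
  by apply: eq_bigr => a _; rewrite !mxE rowK.
set N' := normal_at c F' F1' (phi x).
have [NN Np NF] := normal_at_spec jet' Ux'; rewrite -/N' in NN Np NF.
have NF1 k : <[N', F1 k x]> = 0.
  rewrite ambient_formC chart_change1// sumL big1// => a _.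
  by rewrite ambient_formZl ambient_formC NF mulr0.
have [e ee NE] : exists2 e : R, e * e = 1 &
    forall y, <[y, N']> = e * <[y, normal_at c F F1 x]>.
  by apply: (normal_at_unique jet Ux) => //; rewrite Fphi.
exists M, e; split => //.
  by rewrite -!tangent_gramE TE trmx_mul !mulmxA.
apply/matrixP => i j; rewrite [LHS]mxE -[LHS]mul1r -ee -mulrA -NE chart_change2//.
rewrite [RHS]mxE; congr (_ * _); rewrite sumL.
rewrite -mxform_row mxformE [RHS]exchange_big; apply: eq_bigr => a _ /=.
rewrite ambient_formDl !ambient_formZl [<[F1' a _, N']>]ambient_formC NF mulr0 add0r sumL mulr_sumr.
apply: eq_bigr => b _; rewrite ambient_formZl !mxE -/N'.
by rewrite mulrA; congr (_ * _); rewrite mulrC.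
Qed.

End ChartChange.

(** * Continuity of the characteristic polynomial *)

Section ContinuousCharPoly.
Variables (R : realType) (T : topologicalType) (x : T).

Lemma continuous_det n (A : T -> 'M[R]_n) :
  (forall i j, {for x, continuous (fun y => A y i j)}) ->
  {for x, continuous (fun y => \det (A y))}.
Proof.
apply: (@det_closed _ _ (fun f : T -> R => {for x, continuous f})).
- by move=> b; exact: cst_continuous.
- by move=> f g fc gc; exact: cvgD.
- by move=> f g fc gc; exact: cvgM.
Qed.

Lemma continuous_invmx n (A : T -> 'M[R]_n) :
  (\forall y \near x, A y \in unitmx) ->
  (forall i j, {for x, continuous (fun y => A y i j)}) ->
  forall i j, {for x, continuous (fun y => invmx (A y) i j)}.
Proof.
move=> Au Ac i j.
pose B y := (\det (A y))^-1 * ((-1) ^+ (j + i) * \det (row' j (col' i (A y)))).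
have BE y : A y \in unitmx -> invmx (A y) i j = B y.
  by move=> u; rewrite /invmx u !mxE.
have Bc : {for x, continuous B}.
  apply: cvgM.
    apply: cvgV; last exact: continuous_det.
    by rewrite -unitfE -unitmxE; exact: nbhs_singleton Au.
  apply: cvgM; first exact: cvg_cst.
  apply: continuous_det => k l.
  rewrite (_ : (fun y => _) = (fun y => A y (lift j k) (lift i l))) //.
  by apply/funext => y; rewrite !mxE.
have Bc' : B @ x --> invmx (A x) i j.
  by rewrite BE; [exact: Bc|exact: nbhs_singleton Au].
apply: cvg_trans Bc'; apply: near_eq_cvg; near=> y.
by rewrite BE//; near: y.
Unshelve. all: by end_near. Qed.

Lemma continuous_mulmx m n p (A : T -> 'M[R]_(m, n)) (B : T -> 'M[R]_(n, p)) :
  (forall i j, {for x, continuous (fun y => A y i j)}) ->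
  (forall i j, {for x, continuous (fun y => B y i j)}) ->
  forall i j, {for x, continuous (fun y => (A y *m B y) i j)}.
Proof.
move=> Ac Bc i j; rewrite (_ : (fun y => _) = (fun y => \sum_k A y i k * B y k j)); last first.
  by apply/funext => y; rewrite mxE.
by apply: cvg_sum_ord => k; apply: cvgM; [exact: Ac|exact: Bc].
Qed.

(** Coefficientwise, as a determinant of polynomials. *)
Lemma continuous_char_poly n (A : T -> 'M[R]_n) :
  (forall i j, {for x, continuous (fun y => A y i j)}) ->
  forall k : nat, {for x, continuous (fun y => (char_poly (A y))`_k)}.
Proof.
move=> Ac.
apply: (@det_closed _ _ (fun f : T -> {poly R} =>
  forall k : nat, {for x, continuous (fun y => (f y)`_k)})).
- by move=> a k; exact: cst_continuous.
- move=> f g fc gc k; rewrite (_ : (fun y => _) = (fun y => (f y)`_k + (g y)`_k)).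
    by apply: cvgD; [exact: fc|exact: gc].
  by apply/funext => y; rewrite coefD.
- move=> f g fc gc k.
  rewrite (_ : (fun y => _) = (fun y => \sum_(j < k.+1) (f y)`_j * (g y)`_(k - j))); last first.
    by apply/funext => y; rewrite coefM.
  by apply: cvg_sum_ord => j; apply: cvgM; [exact: fc|exact: gc].
move=> i j k.
rewrite (_ : (fun y => _) = (fun y => ('X *+ (i == j))`_k - (if k == 0%N then A y i j else 0))).
  apply: cvgB; first exact: cvg_cst.
  by case: (k == 0%N); [exact: Ac | exact: cvg_cst].
by apply/funext => y; rewrite !mxE coefB coefC.
Qed.

End ContinuousCharPoly.

(** * Hypersurfaces of space forms *)

Section ImmersedHypersurface.
Variables (R : realType) (n : nat) (c : R) (M : smooth_manifold R n).
Variable f : M -> 'rV[R]_n.+2.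
Hypothesis hf : immersion_in_space_form c f.
Implicit Types (i j : chart_index M) (p q : M) (l : 'rV[R]_n).

Let loc i : 'rV[R]_n -> 'rV[R]_n.+2 := f \o param i.
Let F1 i k := pderive k (loc i).
Let F2 i a k := pderive a (F1 i k).
Let F3 i b a k := pderive b (F2 i a k).

(** The second fundamental form in the chart [i], for the unit normal given by
    the cross product in that chart. *)
Definition shape_form i : 'rV[R]_n -> 'M[R]_n :=
  second_fundamental_form c (loc i) (F1 i) (F2 i).

Lemma chart_jet i : hypersurface_jet c (chart i @` dom i) (loc i) (F1 i) (F2 i) (F3 i).
Proof.
have [fsf fs fr] := hf.
have Uo := @chart_image_open _ _ M i; have s0 := fs i.
have s1 k : smooth_on (chart i @` dom i) (F1 i k) by apply: smooth_on_pderive.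
have s2 a k : smooth_on (chart i @` dom i) (F2 i a k) by apply: smooth_on_pderive.
refine (HypersurfaceJet Uo _ _ _ _ _ _ _ _ _ _).
- move=> k x a Ux; exact (smooth_on_is_derive k a s0 Ux).
- move=> j k x a Ux; exact (smooth_on_is_derive j a (s1 k) Ux).
- move=> b j k x a Ux; exact (smooth_on_is_derive b a (s2 j k) Ux).
- move=> x a Ux; exact (smooth_on_continuous_coord s0 Ux).
- move=> k x a Ux; exact (smooth_on_continuous_coord (s1 k) Ux).
- move=> j k x a Ux; exact (smooth_on_continuous_coord (s2 j k) Ux).
- move=> j k x Ux; exact (smooth_on_pderiveC j k Uo s0 Ux).
- move=> b j k x Ux; exact (smooth_on_pderiveC b j Uo (s1 k) Ux).
- move=> x _; exact (fsf (param i x)).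
- exact (fr i).
Qed.

Lemma chart_image p i : dom i p -> (chart i @` dom i) (chart i p).
Proof. by move=> ip; exists p. Qed.

Definition principal_curvatures p i l := exists P,
  principal_frame (induced_metric c f i (chart i p)) (shape_form i (chart i p)) P l.

Lemma induced_metric_posdef p i : dom i p -> posdef (induced_metric c f i (chart i p)).
Proof. by move=> ip; exact: pullback_metric_posdef (chart_jet i) _ (chart_image ip). Qed.

Lemma principal_curvatures_exists p i : dom i p -> exists l, principal_curvatures p i l.
Proof.
move=> ip; have hT := second_fundamental_form_sym (chart_jet i) (chart_image ip).
by have [P [l fr]] := principal_frame_exists (induced_metric_posdef ip) hT; exists l, P.
Qed.

Lemma hypersurface_gauss p i : dom i p ->
  gauss_equation c (induced_metric c f i) (chart i p) (shape_form i (chart i p)).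
Proof. by move=> ip; exact (gauss_equation_hypersurface (chart_jet i) (chart_image ip)). Qed.

Lemma overlap_open i j : open (chart i @` (dom i `&` dom j)).
Proof.
rewrite openE => _ [p [ip jp] <-].
have ipI := chart_image ip.
have nU : \forall z \near chart i p, (chart i @` dom i) z.
  by apply: open_nbhs_nbhs; split; [exact: chart_image_open|].
have nj : \forall z \near chart i p, dom j (param i z).
  apply: (param_continuous ipI); rewrite chartK//.
  by apply: open_nbhs_nbhs; split; [exact: dom_open|].
rewrite /interior; near=> z.
have [q iq qz] : (chart i @` dom i) z by near: z.
exists q => //; split=> //; rewrite -(chartK iq) qz.
by near: z.
Unshelve. all: by end_near. Qed.

(** Two charts may disagree on the order of the principal curvatures and on
    their common sign, to which [same_products] is insensitive. *)
Lemma principal_curvatures_chart p i j l l' : dom i p -> dom j p ->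
  principal_curvatures p i l -> principal_curvatures p j l' -> same_products l l'.
Proof.
move=> ip jp [P fr] [P' fr'].
pose W := chart i @` (dom i `&` dom j); pose phi := chart j \o param i.
have Ws : smooth_on W phi := transition_smooth i j.
have Wp : W (chart i p) by exists p.
have phip : phi (chart i p) = chart j p by rewrite /phi /= chartK.
have WU : W `<=` chart i @` dom i by move=> _ [q [iq _] <-]; exists q.
have phiW y : W y -> (chart j @` dom j) (phi y).
  by move=> [q [iq jq] <-]; rewrite /phi /= chartK//; exists q.
have Fphi y : W y -> loc i y = loc j (phi y).
  by move=> [q [iq jq] <-]; rewrite /phi /loc /= !chartK.
have dphi a : coord_partial W a phi (pderive a phi).
  by move=> x b Wx; exact (smooth_on_is_derive a b Ws Wx).
have ddphi a b : coord_partial W a (pderive b phi) (pderive a (pderive b phi)).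
  by move=> x d Wx; exact (smooth_on_is_derive a d (smooth_on_pderive b Ws) Wx).
have [D [e [ee gE hE]]] := chart_change (chart_jet i) (chart_jet j) (@overlap_open i j)
  WU phiW Fphi dphi ddphi Wp.
rewrite phip in gE hE.
have fr2 := principal_frame_congr ee gE hE fr.
exact: same_products_trans (same_products_sign l ee) (principal_frame_same_products fr2 fr').
Qed.

Lemma ricci_rank p i l a : dom i p -> principal_curvatures p i l ->
  \rank (eigenspace (ricci_operator (induced_metric c f i) (chart i p)) a)
  = #|[pred k | ricci_weights l 0 k == a - c * n.-1%:R]|.
Proof. by move=> ip [P fr]; exact: ricci_eigenspace_gauss (hypersurface_gauss ip) fr. Qed.

Lemma principal_curvatures_near p i l : (1 < n)%N -> dom i p -> principal_curvatures p i l ->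
  \forall q \near p, forall l', principal_curvatures q i l' ->
    same_counts (ricci_weights l') (ricci_weights l) -> same_products l' l.
Proof.
move=> n1 ip [P fr]; have Up := chart_image ip.
pose A y := shape_form i y *m invmx (induced_metric c f i y).
have Ac a b : {for chart i p, continuous (fun y => A y a b)}.
  apply: continuous_mulmx => {}a {}b.
    exact (continuous_second_fundamental_form (chart_jet i) Up).
  apply: continuous_invmx => [|{}a {}b]; last exact (continuous_metric (chart_jet i) Up).
  near=> y; apply: posdef_unit; apply: (pullback_metric_posdef (chart_jet i)).
  by near: y; apply: open_nbhs_nbhs; split; [exact: chart_image_open|].
have pc (k : nat) : {for p, continuous (fun q => (char_poly (A (chart i q)))`_k)}.
  apply: (@continuous_comp _ _ _ (chart i) (fun y => (char_poly (A y))`_k)).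
    exact: chart_continuous.
  exact: continuous_char_poly.
have := near_same_products n1 pc (principal_frame_char_poly fr).
apply: filterS => q H l' [P' fr']; apply: H.
exact: principal_frame_char_poly fr'.
Unshelve. all: by end_near. Qed.

Lemma constant_ricci_same_counts p q i j l l' : dom i p -> dom j q ->
  constant_ricci_eigenvalues (induced_metric c f) ->
  principal_curvatures p i l -> principal_curvatures q j l' ->
  same_counts (ricci_weights l) (ricci_weights l').
Proof.
move=> ip jq cr lp lq a; pose b := a + c * n.-1%:R.
have bE (w : 'rV[R]_n) :
    #|[pred k | w 0 k == b - c * n.-1%:R]| = #|[pred k | w 0 k == a]| by rewrite addrK.
rewrite -!bE; refine (etrans (esym (ricci_rank b ip lp)) _).
exact (etrans (cr p q i j ip jq b) (ricci_rank b jq lq)).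
Qed.

(** The points whose principal curvatures have the same products as those at
    [p] form an open set, and so do the other points, by
    [principal_curvatures_near]. *)
Lemma constant_ricci_same_products p q i j l l' : (1 < n)%N -> connected [set: M] ->
  constant_ricci_eigenvalues (induced_metric c f) -> dom i p -> dom j q ->
  principal_curvatures p i l -> principal_curvatures q j l' -> same_products l l'.
Proof.
move=> n1 Mc cr ip jq lp lq.
pose C : set M := [set q | forall j l', dom j q -> principal_curvatures q j l' ->
  same_products l l'].
have step a k : dom k a -> \forall b \near a, dom k b /\
    forall la lb, principal_curvatures a k la -> principal_curvatures b k lb ->
      same_products la lb.
  move=> ka; have [la laP] := principal_curvatures_exists ka.
  near=> b; have kb : dom k b.
    by near: b; apply: open_nbhs_nbhs; split; [exact: dom_open|].
  split=> // la' lb la'P lbP.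
  have near_b : forall l', principal_curvatures b k l' ->
      same_counts (ricci_weights l') (ricci_weights la) -> same_products l' la.
    by near: b; exact: principal_curvatures_near.
  apply: (same_products_trans (principal_curvatures_chart ka ka la'P laP)).
  apply/same_products_sym/near_b => //.
  exact (constant_ricci_same_counts kb ka cr lbP laP).
have transport a b k : dom k a -> dom k b ->
    (forall la lb, principal_curvatures a k la -> principal_curvatures b k lb ->
      same_products la lb) -> C a -> C b.
  move=> ka kb ab Ca k' lb k'b lbP.
  have [la laP] := principal_curvatures_exists ka.
  have [lb' lbP'] := principal_curvatures_exists kb.
  apply: (same_products_trans (Ca k la ka laP)).
  apply: (same_products_trans (ab la lb' laP lbP')).
  exact (principal_curvatures_chart kb k'b lbP' lbP).
have Co : open C.
  rewrite openE => a Ca; have [k ka] := dom_cover a.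
  rewrite /interior; apply: filterS (step a k ka) => b [kb ab].
  exact (transport a b k ka kb ab Ca).
have Cco : open (~` C).
  rewrite openE => a Ca; have [k ka] := dom_cover a.
  rewrite /interior; apply: filterS (step a k ka) => b [kb ab] Cb; apply: Ca.
  pose ba lb la lbP laP := same_products_sym (ab la lb laP lbP).
  exact (transport b a k kb ka ba Cb).
have CT : C = [set: M].
  apply: Mc.
  - exists p => k l1 kp l1P; exact (principal_curvatures_chart ip kp lp l1P).
  - by exists C => //; rewrite setTI.
  - by exists C; rewrite ?setTI// -openC.
have Cq : C q by rewrite CT.
exact (Cq j l' jq lq).
Unshelve. all: by end_near. Qed.

End ImmersedHypersurface.

Theorem theorem1p1 (R : realType) (n : nat) (hn : (3 <= n)%N) (c : R)
    (M : smooth_manifold R n) (hM : connected [set: M])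
    (f : M -> 'rV[R]_n.+2) (hf : immersion_in_space_form c f) :
  constant_ricci_eigenvalues (induced_metric c f) <->
  curvature_homogeneous (induced_metric c f).
Proof.
split=> [cr p q i j ip jq|ch p q i j ip jq a].
  have [l [P fr]] := principal_curvatures_exists hf ip.
  have [l' [P' fr']] := principal_curvatures_exists hf jq.
  apply: (gauss_isometry (hypersurface_gauss hf ip) (hypersurface_gauss hf jq) fr fr').
  apply: (constant_ricci_same_products hf (ltnW hn) hM cr ip jq); [by exists P|by exists P'].
have [J [Jg JR]] := ch p q i j ip jq.
have [l [P [gE _]]] := principal_curvatures_exists hf ip.
exact (isometry_ricci gE Jg JR a).
Qed.
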